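(* Let $k\ge 1$ and let $\Gamma$ be a general Martens-special chain of cycles of type $k$. Then $w^1_{k+2}(\Gamma)=0$. In particular, $\Gamma$ has gonality $k+2$.
   Context: Divisors on metric graphs. A metric graph is a compact connected metric space obtained from a finite graph by giving every edge a positive length. A divisor $D$ on a metric graph $\Gamma$ is a finite formal $\mathbb{Z}$-combination of points of $\Gamma$; its degree is the sum of its coefficients; it is effective if all coefficients are $\ge 0$. A rational function on $\Gamma$ is a continuous, piecewise affine function $f:\Gamma\to\mathbb{R}$ with integer slopes and finitely many pieces; $\mathrm{div}(f)$ is the divisor whose coefficient at a point $p$ is the sum of the outgoing slopes of $f$ at $p$ (the sign convention is irrelevant). Divisors $D_1,D_2$ are (linearly) equivalent if $D_1-D_2=\mathrm{div}(f)$ for some rational function $f$. The rank $\mathrm{rk}(D)$ is $-1$ if $D$ is not equivalent to an effective divisor; otherwise it is the largest integer $r\ge 0$ such that for each effective divisor $E$ of degree $r$ there is an effective divisor $D'$ equivalent to $D$ with $D'-E$ effective. Gonality. The gonality of $\Gamma$ is the smallest integer $n$ such that there is a divisor of degree $n$ and rank at least $1$ on $\Gamma$. Brill-Noether numbers. For non-negative integers $r,d$: $w^r_d(\Gamma)=-1$ if there is no divisor $D$ on $\Gamma$ of degree $d$ with $\mathrm{rk}(D)\ge r$. Otherwise $w^r_d(\Gamma)$ is the maximal non-negative integer $w$ such that for each effective divisor $E$ of degree $w+r$ on $\Gamma$ there is an effective divisor $D$ of degree $d$ on $\Gamma$ such that $D-E$ is effective and $\mathrm{rk}(D)\ge r$.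 Chains of cycles. A chain of cycles $\Gamma$ of genus $g\ge 1$ is a metric graph consisting of $g$ cycles $C_1,\dots,C_g$ such that, for $1\le i\le g-1$, $C_i$ and $C_{i+1}$ are connected by a segment going from a point $w_i\in C_i$ to a point $v_{i+1}\in C_{i+1}$; moreover points $v_1\in C_1$ and $w_g\in C_g$ are chosen, and $v_i\ne w_i$ for $1\le i\le g$. Each cycle is given an orientation. Its torsion profile $\underline m=(m_2,\dots,m_g)$ is defined as follows: let $l_i$ be the length of $C_i$ and $l(v_i,w_i)$ the length of the positively oriented arc on $C_i$ from $v_i$ to $w_i$; if $l_i$ is an irrational multiple of $l(v_i,w_i)$ then $m_i=0$, otherwise $m_i$ is the minimal positive integer such that $m_i\cdot l(v_i,w_i)$ is an integer multiple of $l_i$. Martens-special chains. A chain of cycles of genus $g$ is a Martens-special chain of cycles of type $k$ ($k\ge 1$) if there are integers $3\le j_1\le j_2\le\dots\le j_k\le g-2$ with $j_{i+1}-j_i\ge 2$ for $1\le i\le k-1$ such that $m_i\ne 2$ for $i\in\{j_1,\dots,j_k\}$ and $m_i=2$ for $i\in\{2,\dots,g\}\setminus\{j_1,\dots,j_k\}$. It is called general if $m_i=0$ whenever $m_i\ne 2$. *)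

(* Defs.v *)
From HB Require Import structures.
From mathcomp Require Import all_boot all_order all_algebra.
From mathcomp Require Import freeg.
From mathcomp Require Import all_classical all_reals topology normedtype.

Set Implicit Arguments.
Unset Strict Implicit.
Unset Printing Implicit Defensive.

Import Order.TTheory GRing.Theory Num.Theory.
Import numFieldNormedType.Exports.

Local Open Scope classical_set_scope.
Local Open Scope ring_scope.

(** A metric graph is given by a finite model: edges are oriented only to
    parametrize them by [[0, len e]]; loops and multiple edges are allowed. *)
Record metric_graph (R : realType) := MetricGraph {
  vert : finType;
  edge : finType;
  src : edge -> vert;
  tgt : edge -> vert;
  len : edge -> R;
  len_gt0 : forall e, 0 < len e;
  vert_inhabited : (0 < #|vert|)%N;
  vert_connected : forall u v : vert,
    connect [rel x y | [exists e, ((src e == x) && (tgt e == y)) ||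
                                  ((src e == y) && (tgt e == x))]] u v
}.

Section MetricGraph.
Context {R : realType} (G : metric_graph R).

(** Points of the metric space: the vertices, and the pairs [(e, t)] with
    [0 < t < len e] for the interior points of the edges. *)
Definition gpoint : choiceType :=
  (vert G + {x : edge G * R | 0 < x.2 < len x.1})%type.

(** The parametrization [[0, len e] -> G] of the closed edge [e]
    (only used for [t] in this interval). *)
Definition edge_pt (e : edge G) (t : R) : gpoint :=
  match insub (e, t) : option {x : edge G * R | 0 < x.2 < len x.1} with
  | Some x => inr x
  | None => if t <= 0 then inl (src e) else inl (tgt e)
  end.

Definition divisor := {freeg gpoint / int}.

Definition effective (D : divisor) := forall p, 0 <= coeff p D.

(** [G] carries the quotient topology of the disjoint union of its closed
    edges, so continuity is continuity along every closed edge. Affine with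
    finitely many pieces: on each closed edge there is a finite set [s] of
    breakpoints such that [f] is affine with integer slope on every open
    interval that contains no breakpoint. *)
Definition rational_function (f : gpoint -> R) :=
  forall e : edge G,
    {within `[0, len e], continuous (fun t => f (edge_pt e t))} /\
    exists s : seq R, forall a b : R, 0 <= a -> b <= len e ->
      (forall x, x \in s -> ~~ (a < x < b)) ->
      exists (n : int) (c : R), forall t, a < t < b ->
        f (edge_pt e t) = n%:~R * t + c.

(** One-sided slope of [phi] at [t] when leaving [t] in direction
    [sgn] (1 or -1). *)
Definition outslope (phi : R -> R) (t sgn : R) : R :=
  lim ((phi (t + sgn * h) - phi t) / h @[h --> 0^'+]).

(** Sum of the outgoing slopes of [f] at [p]; a loop contributes both of its
    ends to its vertex. *)
Definition ord_at (f : gpoint -> R) (p : gpoint) : R :=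
  match p with
  | inl v =>
      \sum_(e : edge G | src e == v) outslope (f \o edge_pt e) 0 1
      + \sum_(e : edge G | tgt e == v) outslope (f \o edge_pt e) (len e) (-1)
  | inr x =>
      let: (e, t) := val x in
      outslope (f \o edge_pt e) t 1 + outslope (f \o edge_pt e) t (-1)
  end.

Definition is_div (f : gpoint -> R) (D : divisor) :=
  forall p, (coeff p D)%:~R = ord_at f p.

Definition lin_equiv (D1 D2 : divisor) :=
  exists2 f, rational_function f & is_div f (D1 - D2).

End MetricGraph.

(** The largest element of [A]; -1 if there is none. *)
Definition largest (A : set int) : int := xget (-1) (A `&` ubound A).

Section Invariants.
Context {R : realType} (G : metric_graph R).

Definition rk (D : divisor G) : int :=
  if `[< exists2 D', effective D' & lin_equiv D' D >] then
    largest [set r : int | 0 <= r /\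
      forall E : divisor G, effective E -> deg E = r ->
        exists D' : divisor G,
          [/\ effective D', lin_equiv D' D & effective (D' - E)]]
  else -1.

(** The default value 0 is not a possible gonality: a divisor of rank at least 1 has
    positive degree. *)
Definition gonality : int :=
  let A := [set n : int | exists D : divisor G, deg D = n /\ 1 <= rk D] in
  xget 0 (A `&` lbound A).

(** [BN_number r d] is w^r_d. *)
Definition BN_number (r d : nat) : int :=
  if `[< exists D : divisor G, deg D = d%:Z /\ r%:Z <= rk D >] then
    largest [set w : int | 0 <= w /\
      forall E : divisor G, effective E -> deg E = w + r%:Z ->
        exists D : divisor G,
          [/\ effective D, deg D = d%:Z, effective (D - E) & r%:Z <= rk D]]
  else -1.

End Invariants.

(** A chain of cycles is determined by the lengths [cyc_len i] of the cycles
    C_i, the lengths [arc_len i] of the positively oriented arcs from v_i to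
    w_i, and the lengths [seg_len i] of the segments from w_i to v_(i+1).
    Indices start at 1: only the values of [cyc_len] and [arc_len] at
    1, ..., genus and of [seg_len] at 1, ..., genus - 1 are relevant. *)
Record chain_of_cycles (R : realType) := ChainOfCycles {
  genus : nat;
  cyc_len : nat -> R;
  arc_len : nat -> R;
  seg_len : nat -> R;
  genus_gt0 : (0 < genus)%N;
  arc_lenP : forall i, (1 <= i <= genus)%N -> 0 < arc_len i < cyc_len i;
  seg_len_gt0 : forall i, (1 <= i < genus)%N -> 0 < seg_len i
}.

Section ChainGraph.
Context {R : realType} (C : chain_of_cycles R).
Local Notation g := (genus C).

(** [(i, false)] is v_(i+1) and [(i, true)] is w_(i+1). *)
Definition chain_vert : finType := ('I_g * bool)%type.

(** [inl (i, false)] is the positively oriented arc from v_(i+1) to w_(i+1),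
    [inl (i, true)] the positively oriented arc from w_(i+1) to v_(i+1), and
    [inr i] the segment from w_(i+1) to v_(i+2). *)
Definition chain_edge : finType := ('I_g * bool + 'I_g.-1)%type.

Lemma seg_src_subproof (i : 'I_g.-1) : (i < g)%N.
Proof. exact: leq_trans (ltn_ord i) (leq_pred g). Qed.

Lemma seg_tgt_subproof (i : 'I_g.-1) : (i.+1 < g)%N.
Proof. by rewrite -ltn_predRL. Qed.

Definition chain_src (e : chain_edge) : chain_vert :=
  match e with
  | inl x => x
  | inr i => (Ordinal (seg_src_subproof i), true)
  end.

Definition chain_tgt (e : chain_edge) : chain_vert :=
  match e with
  | inl (i, b) => (i, ~~ b)
  | inr i => (Ordinal (seg_tgt_subproof i), false)
  end.

Definition chain_len (e : chain_edge) : R :=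
  match e with
  | inl (i, b) =>
      if b then cyc_len C i.+1 - arc_len C i.+1 else arc_len C i.+1
  | inr i => seg_len C i.+1
  end.

Lemma chain_len_gt0 e : 0 < chain_len e.
Proof.
case: e => [[i b]|i] /=; last by apply: seg_len_gt0; exact: seg_tgt_subproof.
have /andP[a0 al] : 0 < arc_len C i.+1 < cyc_len C i.+1.
  by apply: arc_lenP; rewrite /= ltn_ord.
by case: b => //; rewrite subr_gt0.
Qed.

Lemma chain_vert_inhabited : (0 < #|chain_vert|)%N.
Proof. by rewrite card_prod card_ord card_bool muln_gt0 genus_gt0. Qed.

Lemma chain_vert_connected (u v : chain_vert) :
  connect [rel x y | [exists e, ((chain_src e == x) && (chain_tgt e == y)) ||
                                ((chain_src e == y) && (chain_tgt e == x))]]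
    u v.
Proof.
set r := [rel x y | _].
have r_sym : symmetric r.
  by move=> x y; apply/existsP/existsP => -[e he]; exists e; rewrite orbC.
have rE e : connect r (chain_src e) (chain_tgt e).
  by apply: connect1; apply/existsP; exists e; rewrite !eqxx.
have csym := sym_connect_sym r_sym.
have base n (hn : (n < g)%N) b :
    connect r (Ordinal (genus_gt0 C), false) (Ordinal hn, b).
  elim: n hn b => [|n IHn] hn b.
    rewrite (_ : Ordinal hn = Ordinal (genus_gt0 C)); last exact: val_inj.
    by case: b; [exact: (rE (inl (_, false)))|exact: connect0].
  have hb : connect r (Ordinal (genus_gt0 C), false) (Ordinal hn, false).
    have hn' : (n < g.-1)%N by rewrite ltn_predRL.
    apply: connect_trans (IHn (ltnW hn) true) _.
    have -> : (Ordinal (ltnW hn), true) = chain_src (inr (Ordinal hn')).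
      by congr (_, _); exact: val_inj.
    have -> : (Ordinal hn, false) = chain_tgt (inr (Ordinal hn')).
      by congr (_, _); exact: val_inj.
    exact: rE.
  case: b => //; apply: connect_trans hb _.
  exact: (rE (inl (Ordinal hn, false))).
case: u v => [[i hi] bi] [[j hj] bj].
by apply: connect_trans (base j hj bj); rewrite csym; exact: base.
Qed.

Definition chain_graph : metric_graph R :=
  @MetricGraph R chain_vert chain_edge chain_src chain_tgt chain_len
    chain_len_gt0 chain_vert_inhabited chain_vert_connected.

(** The torsion profile (m_2, ..., m_g), as a function of the index. *)
Definition torsion (i : nat) : nat :=
  let l := cyc_len C i in
  let a := arc_len C i in
  let A := [set m : nat | (0 < m)%N /\ exists z : int, m%:R * a = z%:~R * l] in
  if `[< exists q : rat, l = ratr q * a >] then xget 0%N (A `&` lbound A)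
  else 0%N.

Definition Martens_special (k : nat) :=
  exists j : seq nat,
    [/\ size j = k,
        all (fun i => 3 <= i <= g - 2)%N j,
        sorted (fun i i' => (i <= i') && (2 <= i' - i))%N j,
        forall i, i \in j -> torsion i <> 2%N
      & forall i, (2 <= i <= g)%N -> i \notin j -> torsion i = 2%N].

Definition general_Martens_special (k : nat) :=
  Martens_special k /\
  forall i, (2 <= i <= g)%N -> torsion i <> 2%N -> torsion i = 0%N.

End ChainGraph.

(* Main.v *)
Require Import Defs.
From mathcomp Require Import all_boot all_order all_algebra.
From mathcomp Require Import all_classical all_reals.
From mathcomp Require Import freeg topology normedtype.
From mathcomp Require Import ring lra zify.

(** Retracting a divisor [D] on the cycle C_i gives the sum [theta_i D] of the
    positions of its points, which modulo the length of C_i only depends on the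
    class of [D]. If [D] has rank at least 1, let [N_i] be the maximal degree that
    an effective divisor equivalent to [D] can have on the part of the chain at or
    to the right of w_i, and [M_i] the minimal degree strictly to the right of
    w_i. A chip at w_i shows [M_i < N_i]. Both sequences are nonincreasing; if
    neither drops at i then [N_i] and [M_i] times the position of w_i are both
    [theta_i D], so [N_i - M_i] is a multiple of the torsion m_i, hence is even,
    and i is not one of the k cycles with m_i = 0. Counting the drops, with the
    parity of [N_i - M_i] as potential, yields [N_1 + M_1 >= 2 k + 2] and
    [N_1 >= k + 2], hence the degree is at least k + 2; in degree k + 2 the divisor
    cannot contain v_1 + w_1, which bounds w^1_(k+2).
    Conversely 2 w_1 plus one chip on each of the k special cycles has rank 1:
    the pair of chips can be moved along the chain since 2 v_i ~ 2 w_i if m_i = 2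
    and since the extra chip of a special cycle absorbs the difference. *)

Set Implicit Arguments.
Unset Strict Implicit.
Unset Printing Implicit Defensive.

Import Order.TTheory GRing.Theory Num.Theory.
Import numFieldNormedType.Exports.

Local Open Scope classical_set_scope.
Local Open Scope ring_scope.

(** * Pairings, and piecewise affine functions of one variable *)

Section Pairing.
Context {S : nzRingType} {K : choiceType}.
Implicit Types (D : {freeg K / int}) (h : K -> S).

(** The linear extension of [h] to divisors. The ring [S] is left open: chips are counted in [int],
    positions on a cycle are summed in the reals. *)
Definition pairing h D : S := \sum_(p <- dom D) (coeff p D)%:~R * h p.

Lemma pairingE h D s : uniq s -> {subset dom D <= s} ->
  pairing h D = \sum_(p <- s) (coeff p D)%:~R * h p.
Proof.
move=> us sub; rewrite [RHS](bigID (mem (dom D))) /= [X in _ + X]big1; last first.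
  by move=> p; rewrite mem_dom negbK => /eqP ->; rewrite mulr0z mul0r.
rewrite addr0 -big_filter; apply: perm_big; apply: uniq_perm.
- exact: uniq_dom.
- exact: filter_uniq.
- by move=> p; rewrite mem_filter andb_idr //; apply: sub.
Qed.

Lemma pairingB h D1 D2 : pairing h (D1 - D2) = pairing h D1 - pairing h D2.
Proof.
pose s := undup (dom D1 ++ dom D2 ++ dom (D1 - D2)).
have us : uniq s by exact: undup_uniq.
have sub D : {subset dom D <= dom D1 ++ dom D2 ++ dom (D1 - D2)} ->
    {subset dom D <= s} by move=> H p /H; rewrite mem_undup.
rewrite !(@pairingE _ _ s) //; try by
  apply: sub => p pD; rewrite !mem_cat pD ?orbT.
by rewrite -sumrB; apply: eq_bigr => p _; rewrite coeffB intrB mulrBl.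
Qed.

Lemma pairingU h k p : pairing h << k *g p >> = k%:~R * h p.
Proof.
rewrite (@pairingE _ _ [:: p]) //.
  by rewrite big_seq1 coeffU eqxx mulr1.
move=> q; rewrite mem_dom coeffU inE.
by have [_|_] := eqVneq p q; rewrite // mulr0 eqxx.
Qed.

Lemma pairing0 h : pairing h 0 = 0.
Proof. by rewrite /pairing dom0 big_nil. Qed.

Lemma pairingD h D1 D2 : pairing h (D1 + D2) = pairing h D1 + pairing h D2.
Proof.
by rewrite -{1}[D2]opprK pairingB -[- D2]add0r pairingB pairing0 sub0r opprK.
Qed.

Lemma pairing_deg D : pairing (fun=> 1) D = (deg D)%:~R.
Proof.
rewrite -{2}[D]freeg_sumE raddf_sum rmorph_sum; apply: eq_bigr => p _.
by rewrite mulr1; congr (_ %:~R); rewrite -[LHS](degU _ p).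
Qed.

End Pairing.

(** * Slopes, breakpoints and summation by parts on an interval *)

Section OneDim.
Context {R : realType}.
Implicit Types (phi psi : R -> R) (s : seq R).

(** Exact affinity on a one-sided neighbourhood instead of a limit, so that slopes of sums and
    differences are found by algebra; [outslopeE] returns to the limit. *)
Definition is_slope phi t sgn n :=
  exists2 d, 0 < d & forall h, 0 < h < d -> phi (t + sgn * h) = phi t + n * h.

Lemma outslopeE phi t sgn n : is_slope phi t sgn n -> outslope phi t sgn = n.
Proof.
move=> [d d0 H]; apply: cvg_lim => //.
have cn : (fun=> n) h @[h --> (0 : R)^'+] --> n by exact: cvg_cst.
apply: cvg_trans cn; apply: near_eq_cvg; near=> h.
have h0 : 0 < h by near: h; exact: nbhs_right_gt.
have hd : h < d by near: h; exact: nbhs_right_lt.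
rewrite H ?h0 //.
by field; rewrite gt_eqF.
Unshelve. all: by end_near.
Qed.

Lemma is_slopeB phi psi t sgn m n :
  is_slope phi t sgn m -> is_slope psi t sgn n ->
  is_slope (fun u => phi u - psi u) t sgn (m - n).
Proof.
move=> [d d0 H] [d' d'0 H']; exists (Num.min d d'); first by rewrite lt_min d0.
move=> h /andP[h0]; rewrite lt_min => /andP[hd hd'].
by rewrite H ?H' ?h0 //; ring.
Qed.

Lemma affine_closed phi (a b n c : R) : a < b ->
  {within `[a, b], continuous phi} ->
  (forall t, a < t < b -> phi t = n * t + c) ->
  forall t, a <= t <= b -> phi t = n * t + c.
Proof.
move=> ab /(continuous_within_itvP _ ab)[_ ca cb] H t.
have aff x : (fun u => n * u + c) u @[u --> x] --> n * x + c.
  by apply: cvgD; [apply: cvgM; [exact: cvg_cst|exact: cvg_id]|exact: cvg_cst].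
rewrite !le_eqVlt => /andP[/orP[/eqP <- _|at_]].
  have : phi u @[u --> a^'+] --> n * a + c.
    apply: cvg_trans (cvg_at_right_filter (aff a)); apply: near_eq_cvg.
    near=> u; rewrite H //; apply/andP; split; near: u;
      [exact: nbhs_right_gt|exact: nbhs_right_lt].
  by move=> /(cvg_unique _ ca); apply.
move=> /orP[/eqP ->|tb]; last by apply: H; rewrite at_.
have : phi u @[u --> b^'-] --> n * b + c.
  apply: cvg_trans (cvg_at_left_filter (aff b)); apply: near_eq_cvg.
  near=> u; rewrite H //; apply/andP; split; near: u;
    [exact: nbhs_left_gt|exact: nbhs_left_lt].
by move=> /(cvg_unique _ cb); apply.
Unshelve. all: by end_near.
Qed.

(** Spelled as in [rational_function], so that a rational function restricted to an edge is
    [piecewise_affine] by conversion. *)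
Definition affine_off s phi (L : R) :=
  forall a b : R, 0 <= a -> b <= L ->
    (forall x, x \in s -> ~~ (a < x < b)) ->
    exists (n : int) (c : R), forall t, a < t < b -> phi t = n%:~R * t + c.

Definition piecewise_affine phi (L : R) :=
  {within `[0, L], continuous phi} /\ exists s, affine_off s phi L.

Lemma affine_piece phi s (L a b : R) : {within `[0, L], continuous phi} ->
  affine_off s phi L -> 0 <= a -> a < b -> b <= L ->
  (forall x, x \in s -> ~~ (a < x < b)) ->
  exists n : int, forall t, a <= t <= b -> phi t = phi a + n%:~R * (t - a).
Proof.
move=> cphi aff a0 ab bL nos; have [n [c H]] := aff a b a0 bL nos.
have cab : {within `[a, b], continuous phi}.
  apply: continuous_subspaceW cphi => x /=; rewrite !in_itv /= => /andP[? ?].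
  by apply/andP; split; lra.
have {}H := affine_closed ab cab H.
by exists n => t tab; rewrite !H ?lexx ?(ltW ab) //; ring.
Qed.

Lemma next_right s (t L : R) : t < L ->
  exists b, t < b <= L /\ forall x, x \in s -> ~~ (t < x < b).
Proof.
move=> tL; elim: s => [|y s [b [/andP[tb bL] IH]]].
  by exists L; split => //; rewrite tL lexx.
have [yb|yb] := boolP (t < y < b).
  exists y; split; first by lra.
  move=> x; rewrite inE => /orP[/eqP ->|/IH]; lra.
exists b; split; first by rewrite tb.
by move=> x; rewrite inE => /orP[/eqP ->|/IH].
Qed.

Lemma next_left s (t : R) : 0 < t ->
  exists a, 0 <= a < t /\ forall x, x \in s -> ~~ (a < x < t).
Proof.
move=> t0; elim: s => [|y s [b [/andP[tb bL] IH]]].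
  by exists 0; split => //; rewrite t0 lexx.
have [yb|yb] := boolP (b < y < t).
  exists y; split; first by lra.
  move=> x; rewrite inE => /orP[/eqP ->|/IH]; lra.
exists b; split; first by rewrite tb.
by move=> x; rewrite inE => /orP[/eqP ->|/IH].
Qed.

Lemma piece_slope_right phi (a b n : R) : a < b ->
  (forall t, a <= t <= b -> phi t = phi a + n * (t - a)) -> is_slope phi a 1 n.
Proof.
move=> ab H; exists (b - a); first by lra.
by move=> h ?; rewrite H; [ring|lra].
Qed.

Lemma piece_slope_left phi (a b n : R) : a < b ->
  (forall t, a <= t <= b -> phi t = phi a + n * (t - a)) ->
  is_slope phi b (-1) (- n).
Proof.
move=> ab H; exists (b - a); first by lra.
by move=> h ?; rewrite H ?[phi b]H; [ring|lra|lra].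
Qed.

Lemma slope_right phi L t : piecewise_affine phi L -> 0 <= t < L ->
  exists n : int, is_slope phi t 1 n%:~R.
Proof.
move=> [cphi [s aff]] /andP[t0 tL].
have [b [/andP[tb bL] nos]] := next_right s tL.
have [n H] := affine_piece cphi aff t0 tb bL nos.
by exists n; exact: piece_slope_right H.
Qed.

Lemma slope_left phi L t : piecewise_affine phi L -> 0 < t <= L ->
  exists n : int, is_slope phi t (-1) n%:~R.
Proof.
move=> [cphi [s aff]] /andP[t0 tL].
have [a [/andP[a0 at_] nos]] := next_left s t0.
have [n H] := affine_piece cphi aff a0 at_ tL nos.
by exists (- n); rewrite intrN; exact: piece_slope_left H.
Qed.

Lemma piecewise_affineB phi psi L : piecewise_affine phi L ->
  piecewise_affine psi L -> piecewise_affine (fun t => phi t - psi t) L.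
Proof.
move=> [c1 [s1 a1]] [c2 [s2 a2]]; split.
  by move=> x; apply: cvgB; [exact: c1|exact: c2].
exists (s1 ++ s2) => a b a0 bL H.
have [x xs|n1 [d1 H1]] := a1 a b a0 bL; first by apply: H; rewrite mem_cat xs.
have [x xs|n2 [d2 H2]] := a2 a b a0 bL.
  by apply: H; rewrite mem_cat xs orbT.
exists (n1 - n2), (d1 - d2) => t tab.
by rewrite H1 // H2 // intrB; ring.
Qed.

(** Induction on the subdivision [T] with a moving left end [a]. On a single piece of slope [n] the
    two boundary terms differ by [- n * be] times its length, which is [- be] times the increment of
    [phi]. *)
Lemma green_path phi s L al be (cphi : {within `[0, L], continuous phi})
    (aff : affine_off s phi L) (T : seq R) (a : R) :
  0 <= a -> path <%R a (rcons T L) ->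
  (forall x, x \in s -> a < x < L -> x \in T) ->
  outslope phi a 1 * (al + be * a)
  + \sum_(t <- T) (outslope phi t 1 + outslope phi t (-1)) * (al + be * t)
  + outslope phi L (-1) * (al + be * L) = - be * (phi L - phi a).
Proof.
elim: T a => [|w T IH] a a0 /=.
  rewrite andbT => aL nos.
  have [x xs|n H] := affine_piece cphi aff a0 aL (lexx L).
    by apply/negP => /(nos x xs).
  rewrite big_nil (outslopeE (piece_slope_right aL H)).
  rewrite (outslopeE (piece_slope_left aL H)) (H L) ?lexx ?(ltW aL) //; ring.
move=> /andP[aw pw] cov.
have wL : w < L.
  move: pw; rewrite lt_path_sortedE => /andP[/allP/(_ L)].
  by rewrite mem_rcons mem_head => /(_ isT).
have [x xs|n H] := affine_piece cphi aff a0 aw (ltW wL).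
  apply/negP => /andP[ax xw]; have := cov x xs.
  rewrite ax (lt_trans xw wL) inE => /(_ isT) /orP[/eqP xE|xT].
    by rewrite xE ltxx in xw.
  move: pw; rewrite lt_path_sortedE => /andP[/allP/(_ x)].
  by rewrite mem_rcons inE xT orbT => /(_ isT) /(lt_trans xw); rewrite ltxx.
have := IH w (le_trans a0 (ltW aw)) pw.
have /[swap]/[apply] : forall x, x \in s -> w < x < L -> x \in T.
  move=> x xs /andP[wx xL]; have := cov x xs.
  rewrite xL (lt_trans aw wx) inE => /(_ isT) /orP[/eqP xE|//].
  by rewrite xE ltxx in wx.
rewrite big_cons (outslopeE (piece_slope_right aw H)).
rewrite (outslopeE (piece_slope_left aw H)) (H w) ?lexx ?(ltW aw) //.
set S := \sum_(_ <- _) _; set o1 := outslope _ _ _; set o2 := outslope _ _ _.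
(* The left slope [- n] at [w] belongs to the piece removed; together with the term at [a] it leaves
   [- n * be * (w - a)]. *)
move=> E; have -> : n%:~R * (al + be * a) + ((o1 - n%:~R) * (al + be * w) + S)
   + o2 * (al + be * L) = (o1 * (al + be * w) + S + o2 * (al + be * L))
     - n%:~R * be * (w - a) by ring.
by rewrite E; ring.
Qed.

(* Summation by parts against the affine function [al + be * t]. *)
Lemma green phi s L al be (T : seq R) : 0 < L ->
  {within `[0, L], continuous phi} -> affine_off s phi L ->
  uniq T -> (forall t, t \in T -> 0 < t < L) ->
  (forall x, x \in s -> 0 < x < L -> x \in T) ->
  outslope phi 0 1 * al
  + \sum_(t <- T) (outslope phi t 1 + outslope phi t (-1)) * (al + be * t)
  + outslope phi L (-1) * (al + be * L) = - be * (phi L - phi 0).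
Proof.
move=> L0 cphi aff uT Tin cov.
rewrite -(green_path al be cphi aff (T := sort <=%R T) (lexx 0)).
- rewrite mulr0 addr0; do 2 congr (_ + _).
  by apply: perm_big; rewrite perm_sym perm_sort.
- rewrite lt_path_sortedE -[rcons _ _]cats1 all_cat /= L0 !andbT all_sort.
  apply/andP; split; first by apply/allP => t /Tin /andP[].
  have sT : sorted <%R (sort <=%R T) by rewrite sort_lt_sorted.
  rewrite cats1; case E : (sort <=%R T) sT => [//|w T'] /= pT.
  rewrite rcons_path pT /=.
  have : last w T' \in sort <=%R T by rewrite E mem_last.
  by rewrite mem_sort => /Tin /andP[].
- by move=> x xs xin; rewrite mem_sort; apply: cov.
Qed.

End OneDim.

(** * Principal divisors *)

Section Principal.
Context {R : realType} {G : metric_graph R}.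
Implicit Types (f : gpoint G -> R) (D : divisor G) (e : edge G).

Lemma edge_pt_src e : edge_pt e 0 = inl (src e).
Proof. by rewrite /edge_pt insubF /= ?ltxx // lexx. Qed.

Lemma edge_pt_tgt e : edge_pt e (len e) = inl (tgt e).
Proof. by rewrite /edge_pt insubF /= ?ltxx ?andbF // leNgt len_gt0. Qed.

Lemma edge_pt_in e t (ht : 0 < (e, t).2 < len (e, t).1) :
  edge_pt e t = inr (exist _ (e, t) ht).
Proof. by rewrite /edge_pt insubT. Qed.

Lemma vertex_neq_edge_pt v e t : 0 < t < len e -> (inl v == edge_pt e t) = false.
Proof. by move=> ht; rewrite (@edge_pt_in e t ht). Qed.

Lemma edge_pt_eq e e' (c t : R) : 0 <= c <= len e -> 0 < t < len e' ->
  (edge_pt e c == edge_pt e' t) = (e' == e) && (c == t).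
Proof.
move=> /andP[c0 cl] ht; have /andP[t0 tl] := ht.
move: c0; rewrite le_eqVlt => /orP[/eqP <-|c0].
  by rewrite edge_pt_src vertex_neq_edge_pt // lt_eqF ?andbF.
move: cl; rewrite le_eqVlt => /orP[/eqP ->|cl].
  rewrite edge_pt_tgt vertex_neq_edge_pt //; have [E|//] := eqVneq e' e.
  by rewrite -E gt_eqF.
have hc : 0 < c < len e by rewrite c0.
apply/eqP/andP => [|[/eqP -> /eqP -> //]].
by rewrite (@edge_pt_in e c hc) (@edge_pt_in e' t ht) => -[-> ->]; rewrite !eqxx.
Qed.

Lemma gpointP (P : gpoint G -> Prop) :
  (forall v, P (inl v)) ->
  (forall e t, 0 < t < len e -> P (edge_pt e t)) -> forall p, P p.
Proof.
move=> Pv Pe [v|[[e t] ht]]; first exact: Pv.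
by rewrite -(edge_pt_in ht); apply: Pe.
Qed.

Lemma ord_at_edge f e t : 0 < t < len e ->
  ord_at f (edge_pt e t) =
  outslope (f \o edge_pt e) t 1 + outslope (f \o edge_pt e) t (-1).
Proof. by move=> ht; rewrite (@edge_pt_in e t ht). Qed.

Lemma outslope_right f e t : rational_function f -> 0 <= t < len e ->
  exists n : int, is_slope (f \o edge_pt e) t 1 n%:~R.
Proof. by move=> rf; apply: slope_right; exact: (rf e). Qed.

Lemma outslope_left f e t : rational_function f -> 0 < t <= len e ->
  exists n : int, is_slope (f \o edge_pt e) t (-1) n%:~R.
Proof. by move=> rf; apply: slope_left; exact: (rf e). Qed.

Lemma rational_functionB f g : rational_function f -> rational_function g ->
  rational_function (fun p => f p - g p).
Proof. by move=> rf rg e; apply: piecewise_affineB; [exact: rf|exact: rg]. Qed.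

Lemma ord_atB f g p : rational_function f -> rational_function g ->
  ord_at (fun q => f q - g q) p = ord_at f p - ord_at g p.
Proof.
move=> rf rg.
have Hr e t : 0 <= t < len e -> outslope ((fun q => f q - g q) \o edge_pt e) t 1 =
    outslope (f \o edge_pt e) t 1 - outslope (g \o edge_pt e) t 1.
  move=> ht; have [m hm] := outslope_right rf ht.
  have [n hn] := outslope_right rg ht.
  by rewrite (outslopeE hm) (outslopeE hn) (outslopeE (is_slopeB hm hn)).
have Hl e t : 0 < t <= len e -> outslope ((fun q => f q - g q) \o edge_pt e) t (-1) =
    outslope (f \o edge_pt e) t (-1) - outslope (g \o edge_pt e) t (-1).
  move=> ht; have [m hm] := outslope_left rf ht.
  have [n hn] := outslope_left rg ht.
  by rewrite (outslopeE hm) (outslopeE hn) (outslopeE (is_slopeB hm hn)).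
elim/gpointP: p => [v|e t ht].
  rewrite /= opprD addrACA -!sumrB; congr (_ + _); apply: eq_bigr => e _.
    by rewrite Hr // lexx len_gt0.
  by rewrite Hl // lexx len_gt0.
have /andP[t0 tl] := ht.
rewrite !ord_at_edge // Hr ?Hl ?t0 ?tl ?ltW //; ring.
Qed.

Definition principal D := exists2 f, rational_function f & is_div f D.

Lemma principal0 : principal 0.
Proof.
have rc : rational_function (fun _ : gpoint G => 0 : R).
  move=> e; split; first by move=> x; exact: cvg_cst.
  by exists [::] => a b _ _ _; exists 0, 0 => t _; rewrite mul0r addr0.
exists (fun=> 0) => // p; rewrite coeff0.
by have := ord_atB p rc rc; rewrite !subrr => ->.
Qed.

Lemma principalB D1 D2 : principal D1 -> principal D2 -> principal (D1 - D2).
Proof.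
move=> [f rf df] [g rg dg]; exists (fun p => f p - g p).
  exact: rational_functionB.
by move=> p; rewrite coeffB intrB df dg ord_atB.
Qed.

Lemma principalN D : principal D -> principal (- D).
Proof. by move=> pD; rewrite -sub0r; apply: principalB => //; exact: principal0. Qed.

Lemma principalD D1 D2 : principal D1 -> principal D2 -> principal (D1 + D2).
Proof. by move=> p1 /principalN p2; rewrite -[D2]opprK; apply: principalB. Qed.

Lemma lin_equiv_refl D : lin_equiv D D.
Proof. by rewrite /lin_equiv subrr; exact: principal0. Qed.

Lemma lin_equiv_sym D1 D2 : lin_equiv D1 D2 -> lin_equiv D2 D1.
Proof. by move=> /principalN; rewrite opprB. Qed.

Lemma lin_equiv_trans D2 D1 D3 :
  lin_equiv D1 D2 -> lin_equiv D2 D3 -> lin_equiv D1 D3.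
Proof. by move=> p1 /(principalD p1); rewrite addrA subrK. Qed.

Lemma lin_equiv_addr D D1 D2 : lin_equiv D1 D2 -> lin_equiv (D1 + D) (D2 + D).
Proof. by rewrite /lin_equiv opprD addrACA subrr addr0. Qed.

(** Green's formula with a test function [h] that is affine on open edges but may jump at their
    ends. The first two terms record the jumps; a position on a cycle has one where the cycle closes
    up. *)
Lemma green_graph f D (h : gpoint G -> R) (al be : edge G -> R) :
  rational_function f -> is_div f D ->
  (forall e t, 0 < t < len e -> h (edge_pt e t) = al e + be e * t) ->
  pairing h D = \sum_e
    (outslope (f \o edge_pt e) 0 1 * (h (inl (src e)) - al e)
     + outslope (f \o edge_pt e) (len e) (-1)
       * (h (inl (tgt e)) - (al e + be e * len e))
     - be e * (f (inl (tgt e)) - f (inl (src e)))).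
Proof.
move=> rf df hh.
have [s hs] := choice (fun e => (rf e).2).
(* [X e] lists the parameters of the points of [D] inside [e]. Joined to the breakpoints of [f] they
   give a subdivision [T e] that serves both [green] and the support of [D]. *)
pose X e := pmap (fun p : gpoint G => if p is inr x then
  (if (val x).1 == e then Some (val x).2 else None) else None) (dom D).
pose T e := undup [seq t <- s e ++ X e | 0 < t < len e].
have Tin e t : t \in T e -> 0 < t < len e.
  by rewrite mem_undup mem_filter => /andP[].
pose pts : seq (gpoint G) := [seq inl v | v <- enum (vert G)] ++
  [seq edge_pt e t | e <- enum (edge G), t <- T e].
have upts : uniq pts.
  rewrite cat_uniq map_inj_uniq ?enum_uniq /=; last by move=> u v [].
  apply/andP; split.
    apply/hasPn => p /allpairsPdep[e [t [_ /Tin ht ->]]].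
    by rewrite (@edge_pt_in e t ht); apply/negP => /mapP[].
  apply: allpairs_uniq_dep; first exact: enum_uniq.
    by move=> e _; exact: undup_uniq.
  move=> _ _ /allpairsPdep[e [t [_ /Tin ht ->]]]
    /allpairsPdep[e' [t' [_ /Tin ht' ->]]].
  by rewrite /= (@edge_pt_in e t ht) (@edge_pt_in e' t' ht') => -[-> ->].
have sub : {subset dom D <= pts}.
  elim/gpointP => [v _|e t ht pD]; rewrite mem_cat.
    by rewrite (map_f (fun v => inl v : gpoint G)) // mem_enum.
  apply/orP; right; apply/allpairsPdep; exists e, t; split; rewrite ?mem_enum //.
  rewrite mem_undup mem_filter ht mem_cat; apply/orP; right.
  rewrite mem_pmap; apply/mapP; exists (edge_pt e t) => //.
  by rewrite (@edge_pt_in e t ht) /= eqxx.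
rewrite (pairingE _ upts sub) big_cat big_map big_allpairs_dep /= !big_enum /=.
rewrite (eq_bigr (fun v =>
  \sum_(e | src e == v) outslope (f \o edge_pt e) 0 1 * h (inl (src e))
  + \sum_(e | tgt e == v)
      outslope (f \o edge_pt e) (len e) (-1) * h (inl (tgt e)))); last first.
  move=> v _; rewrite df /= mulrDl !big_distrl /=.
  by congr (_ + _); apply: eq_bigr => e /eqP ->.
have partE (F : edge G -> R) (d : edge G -> vert G) :
    \sum_v \sum_(e | d e == v) F e = \sum_e F e.
  by rewrite [RHS](partition_big d xpredT).
rewrite big_split /= !partE -!big_split /=.
apply: eq_bigr => e _.
have := @green R (f \o edge_pt e) (s e) (len e) (al e) (be e) (T e) (len_gt0 e)
  (rf e).1 (hs e) (undup_uniq _) (Tin e).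
rewrite /= edge_pt_src edge_pt_tgt.
have /[swap]/[apply] : forall x, x \in s e -> 0 < x < len e -> x \in T e.
  by move=> x xs hx; rewrite mem_undup mem_filter hx mem_cat xs.
rewrite (eq_big_seq (fun t => (coeff (edge_pt e t) D)%:~R * h (edge_pt e t)));
  last first.
  by move=> t /Tin ht; rewrite df ord_at_edge // hh.
set S := \sum_(_ <- _) _; set o1 := outslope _ _ _; set o2 := outslope _ _ _.
move=> E; rewrite -mulNr -E; ring.
Qed.

Lemma principal_deg D : principal D -> deg D = 0.
Proof.
move=> [f rf df]; apply: (@intr_inj R).
rewrite -pairing_deg (@green_graph f D (fun=> 1) (fun=> 1) (fun=> 0)) //.
  by rewrite big1 // => e _; rewrite !mul0r addr0 subrr !mulr0 !addr0 subr0.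
by move=> *; rewrite mul0r addr0.
Qed.

Lemma lin_equiv_deg D1 D2 : lin_equiv D1 D2 -> deg D1 = deg D2.
Proof. by move=> /principal_deg; rewrite degB => /subr0_eq. Qed.

End Principal.

(** * Rank *)

Lemma largest_mem (A : set int) : largest A <> -1 -> A (largest A).
Proof. by rewrite /largest; case: xgetP => // x _ []. Qed.

Lemma int_set_max (A : set int) (x b : int) :
  A x -> (forall y, A y -> y <= b) ->
  exists m, A m /\ forall y, A y -> y <= m.
Proof.
move=> Ax ub; pose P n := `[< A (x + n%:Z) >].
have exP : exists n, P n by exists 0%N; apply/asboolP; rewrite addr0.
have ubP n : P n -> (n <= `|b - x|)%N by move=> /asboolP /ub; lia.
case: (ex_maxnP exP ubP) => n /asboolP An maxn.
exists (x + n%:Z); split => // y Ay.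
have [xy|] := lerP x y; last by lia.
have := maxn `|y - x|%N; rewrite /P.
have -> : x + `|y - x|%N%:Z = y by lia.
by move=> /(_ (asboolT Ay)); lia.
Qed.

Lemma int_set_min (A : set int) (x b : int) :
  A x -> (forall y, A y -> b <= y) ->
  exists m, A m /\ forall y, A y -> m <= y.
Proof.
move=> Ax lb.
have [||m [Am mmax]] := @int_set_max [set y | A (- y)] (- x) (- b).
- by rewrite /= opprK.
- by move=> y /lb; lia.
exists (- m); split => // y Ay; have := mmax (- y).
by rewrite /= opprK => /(_ Ay); lia.
Qed.

Lemma largest_eq (A : set int) (x : int) :
  A x -> (forall y, A y -> y <= x) -> largest A = x.
Proof.
move=> Ax ub; apply: xget_unique; first by split.
by move=> y [Ay uy]; apply/eqP; rewrite eq_le ub // uy.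
Qed.

(** The upper bound matters: on an unbounded set [largest] takes its default value -1. *)
Lemma largest_ge (A : set int) (x b : int) :
  A x -> (forall y, A y -> y <= b) -> x <= largest A.
Proof.
move=> Ax ub; have [m [Am mub]] := int_set_max Ax ub.
by rewrite (largest_eq Am mub) mub.
Qed.

Section Rank.
Context {R : realType} {G : metric_graph R}.
Implicit Types (D E : divisor G) (p : gpoint G).

Lemma effective_deg_ge0 D : effective D -> 0 <= deg D.
Proof.
move=> eD; rewrite -[deg D]intz -pairing_deg; apply: sumr_ge0 => p _.
by rewrite mulr1 intz.
Qed.

Lemma effectiveD D E : effective D -> effective E -> effective (D + E).
Proof. by move=> eD eE p; rewrite coeffD addr_ge0. Qed.

Lemma effectiveU (n : int) p : 0 <= n -> effective << n *g p >>.
Proof. by move=> n0 q; rewrite coeffU mulr_ge0. Qed.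

Lemma effective0 : effective (0 : divisor G).
Proof. by move=> p; rewrite coeff0. Qed.

Lemma deg1_effective E : effective E -> deg E = 1 -> exists p, E = << p >>.
Proof. by move=> eE; apply: deg1pos; apply/fgposP. Qed.

(** An effective divisor of degree 1 is a single point, and containing [r] chips at a point implies
    containing one when [r >= 1]. *)
Lemma rk_ge1P D : 1 <= rk D <->
  forall p, exists D', [/\ effective D', lin_equiv D' D & 1 <= coeff p D'].
Proof.
split=> [|H].
  rewrite /rk; case: asboolP => // -[D0 eD0 lD0]; set A := [set r | _] => h p.
  have [r0 Ar] : A (largest A) by apply: largest_mem => E; move: h; rewrite E.
  have [||D' [eD' lD' dE]] := Ar << largest A *g p >>.
  - exact: effectiveU.
  - exact: degU.
  - exists D'; split => //; apply: le_trans h _.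
    by move: (dE p); rewrite coeffB coeffU eqxx mulr1 subr_ge0.
have /card_gt0P[v _] := vert_inhabited G.
rewrite /rk asboolT; last by have [D' [eD' lD' _]] := H (inl v); exists D'.
apply: (@largest_ge _ _ (deg D)).
  split=> // E eE /(deg1_effective eE)[p ->].
  have [D' [eD' lD' c1]] := H p; exists D'; split=> // q.
  rewrite coeffB coeffU mul1r; have [<-|_] := eqVneq p q; first by rewrite subr_ge0.
  by rewrite subr0.
(* Testing [r] against [r] chips at one vertex gives [r <= deg D], so the set defining the rank is
   bounded. *)
move=> r [r0 /(_ << r *g inl v >> (effectiveU _ r0) (degU _ _))].
move=> [D' [eD' lD' /effective_deg_ge0]].
by rewrite degB degU (lin_equiv_deg lD') subr_ge0.
Qed.

Lemma rk_ge1_equiv D D' : lin_equiv D D' -> 1 <= rk D -> 1 <= rk D'.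
Proof.
move=> l /rk_ge1P H; apply/rk_ge1P => p; have [E [eE lE cE]] := H p.
by exists E; split => //; exact: lin_equiv_trans l.
Qed.

End Rank.

(** * The counting argument *)

Lemma path_bound (g : nat) (J : seq nat) (N M : nat -> int) :
  (0 < size J)%N -> uniq J ->
  (forall j, j \in J -> (3 <= j <= g - 2)%N /\ j.-1 \notin J) ->
  (forall i, (i < g)%N -> M i + 1 <= N i) -> 0 <= M g.-1 ->
  (forall i, (i.+1 < g)%N -> [/\ N i.+1 <= N i, M i.+1 <= M i
     & N i.+1 = N i -> M i.+1 = M i ->
       i.+2 \notin J /\ ((N i - M i) %% 2)%Z = 0]) ->
  2 * (size J)%:Z + 2 + ((N 0%N - M 0%N) %% 2)%Z <= N 0%N + M 0%N.
Proof.
move=> J0 uJ hJ hNM hM hstep.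
have [x xJ] : exists x, x \in J.
  by case: (J) J0 => // x ? _; exists x; rewrite mem_head.
have [gx _] := hJ _ xJ.
pose c i := count (fun j => (j <= i)%N) J.
have cS i : c i.+1 = (c i + (i.+1 \in J))%N.
  rewrite -count_uniq_mem // /c -count_predUI -[LHS]addn0; congr (_ + _)%N.
    by apply: eq_count => j /=; rewrite leq_eqVlt ltnS orbC.
  rewrite (@eq_count _ _ pred0) ?count_pred0 // => j /=.
  by case: eqP => [->|_]; rewrite ?andbF // ltnn.
have c1 : c 1%N = 0%N.
  apply/eqP; rewrite -leqn0 leqNgt -has_count; apply/hasPn => j /hJ[].
  by lia.
have cg : c g = size J.
  by apply/eqP; rewrite -all_count; apply/allP => j /hJ[]; lia.
pose phi i : int := ((N i - M i) %% 2)%Z.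
(* Total drop up to [i], corrected by the parity [phi]. It never decreases: a drop by 1 adds 0 or 2
   to it, and a larger drop adds at least 2. *)
pose Psi i := N 0%N - N i + (M 0%N - M i) + phi i - phi 0%N.
(* The second clause is a reserve. If [phi i = 1] at a nonspecial index, the last step was a drop
   that raised [Psi] by 2 beyond the count. This pays for a following special step, where a drop by
   1 from odd to even leaves [Psi] unchanged. *)
have H i : (i < g)%N -> 2 * (c i.+1)%:Z <= Psi i /\
    ((0 < i)%N -> i.+1 \notin J -> phi i = 1 -> 2 * (c i.+1)%:Z + 2 <= Psi i).
  elim: i => [|i IH] ig; first by rewrite c1 /Psi; split; lia.
  have [] := IH (ltnW ig); have [] := hstep i ig.
  have := hNM _ ig; have := hNM _ (ltnW ig).
  rewrite (cS i.+1) /Psi /phi.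
  have [iJ|iJ] := boolP (i.+2 \in J) => /=.
    (* No two special indices are adjacent and all are at least 3, so the reserve is available at
       [i]. *)
    have [i3 /= ->] := hJ _ iJ; move=> ? ? ? ? A ? B; split => //.
    have {}A : ~ (N i.+1 = N i /\ M i.+1 = M i) by case=> /A{}A /A[].
    have {}B := B _ isT; lia.
  move=> ? ? ? ? A ? B.
  have {}A : (N i.+1 = N i /\ M i.+1 = M i) -> ((N i - M i) %% 2)%Z = 0.
    by case=> /A{}A /A[].
  split; lia.
(* At the last index either [N - M] is even, hence at least 2, or it is odd and the reserve applies
   because [g] is not special. *)
have gg : (g.-1 < g)%N by lia.
have [] := H _ gg; have := hNM _ gg.
have gJ : g \notin J by apply/negP => /hJ[]; lia.
have gE : g.-1.+1 = g by lia.
rewrite gE cg gJ /Psi => ? A B.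
have g1 : (0 < g.-1)%N by lia.
have {}B := B g1 isT; rewrite /phi in A B *.
lia.
Qed.

(** * Retractions on the cycles of a chain *)

Section ChainCoordinates.
Context {R : realType} (C : chain_of_cycles R).
Local Notation g := (genus C).
Local Notation G := (chain_graph C).
Local Notation arc i := (arc_len C i.+1).
Local Notation cyc i := (cyc_len C i.+1).

(* From left to right along the chain: [3 * i] on the cycle [i] minus its
   vertex w, [3 * i + 1] at this vertex, [3 * i + 2] inside the next segment. *)
Definition depth (p : gpoint G) : nat :=
  match p with
  | inl (j, b) => 3 * j + b
  | inr x =>
    match (val x).1 with
    | inl (j, _) => 3 * j
    | inr j => 3 * j + 2
    end
  end.

(** The position on cycle [i] of the retraction of the source of [e]: v has position 0 and w has
    position [arc i]; everything to the left retracts to v, everything to the right to w. *)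
Definition coord_off (i : nat) (e : chain_edge C) : R :=
  match e with
  | inl (j, b) =>
      if (j < i)%N then 0
      else if j == i :> nat then (if b then arc i else 0) else arc i
  | inr j => if (j < i)%N then 0 else arc i
  end.

Definition on_cycle (i : nat) (e : chain_edge C) : bool :=
  if e is inl (j, _) then j == i :> nat else false.

(* The position in [[0, cyc i]] of the retraction of [p] on the cycle [i]. *)
Definition coord (i : nat) (p : gpoint G) : R :=
  match p with
  | inl x => coord_off i (inl x)
  | inr x => coord_off i (val x).1 + (on_cycle i (val x).1)%:R * (val x).2
  end.

Lemma coord_edge i (e : edge G) t : 0 < t < len e ->
  coord i (edge_pt e t) = coord_off i e + (on_cycle i e)%:R * t.
Proof. by move=> ht; rewrite (@edge_pt_in _ _ e t ht). Qed.

Lemma depth_edge (e : edge G) t : 0 < t < len e ->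
  depth (edge_pt e t) =
  match e with inl (j, _) => 3 * j | inr j => 3 * j + 2 end%N.
Proof. by move=> ht; rewrite (@edge_pt_in _ _ e t ht). Qed.

Lemma coord_right i p : (3 * i + 1 <= depth p)%N -> coord i p = arc i.
Proof.
elim/(@gpointP R G): p => [[j b]|e t ht] /=.
  by move=> hj; case: ltngtP => ji; case: b hj => //= hj; lia.
rewrite depth_edge // coord_edge //; case: e {ht} => [[j b]|j] /= hj.
  by case: ltngtP => ji; first (by lia); rewrite ?mul0r ?addr0 //; lia.
by rewrite mul0r addr0; case: ifP => //; lia.
Qed.

Lemma coord_left i p : (depth p < 3 * i)%N -> coord i p = 0.
Proof.
elim/(@gpointP R G): p => [[j b]|e t ht] /=.
  by move=> hj; case: ltngtP => ji; case: b hj => //= hj; lia.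
rewrite depth_edge // coord_edge //; case: e {ht} => [[j b]|j] /= hj.
  by case: ltngtP => ji; rewrite ?mul0r ?addr0 //; lia.
by rewrite mul0r addr0; case: ifP => //; lia.
Qed.

Lemma coord_src i (e : edge G) : coord i (inl (src e)) = coord_off i e.
Proof.
by case: e => [[j b]|j] //=; case: ltngtP.
Qed.

(** The excluded edge is the arc from w back to v: along it the position tends to [cyc i], while v
    itself has position 0. *)
Lemma coord_tgt (i : 'I_g) (e : edge G) : e != inl (i, true) ->
  coord i (inl (tgt e)) = coord_off i e + (on_cycle i e)%:R * len e.
Proof.
case: e => [[j b]|j] /=.
  have [-> /=|ji _] := eqVneq j i.
    by case: b => [/eqP //|_]; rewrite ltnn eqxx mul1r add0r.
  by rewrite (negbTE (ji : (j : nat) != i)) mul0r addr0.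
by move=> _; rewrite mul0r addr0; case: (ltngtP j.+1 i); do ?case: ifP.
Qed.

Lemma sum_cycle_edges (F : edge G -> R) (i : 'I_g) :
  (forall e, e != inl (i, false) -> e != inl (i, true) -> F e = 0) ->
  \sum_e F e = F (inl (i, false)) + F (inl (i, true)).
Proof.
move=> F0; rewrite (bigD1 (inl (i, false) : edge G)) //=; congr (_ + _).
rewrite (bigD1 (inl (i, true) : edge G)) /=; last by apply/eqP => -[].
by rewrite big1 ?addr0 // => e /andP[] /F0.
Qed.

(** In [green_graph] the increments of [f] along the two arcs of the cycle cancel. What remains is
    the jump of height [cyc i] at the end of the returning arc, times an integer slope of [f]. *)
Lemma principal_coord (i : 'I_g) (D : divisor G) : principal D ->
  exists z : int, pairing (coord i) D = z%:~R * cyc i.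
Proof.
move=> [f rf df]; rewrite (green_graph rf df (@coord_edge i)).
have [n hn] : exists n : int,
    is_slope (f \o edge_pt (inl (i, true) : edge G)) (cyc i - arc i) (-1) n%:~R.
  apply: outslope_left => //=; rewrite lexx andbT.
  exact: (chain_len_gt0 (inl (i, true))).
exists (- n); rewrite (@sum_cycle_edges _ i) => [|e ne1 ne2].
  rewrite !coord_src /= ltnn eqxx (outslopeE hn) intrN mulr1n; ring.
rewrite coord_src coord_tgt // !subrr !mulr0 addr0 sub0r.
case: e ne1 ne2 => [[j b]|j] /=; last by rewrite mul0r oppr0.
have [->|ji _ _] := eqVneq j i; first by case: b; rewrite eqxx.
by rewrite (negbTE (ji : (j : nat) != i)) mul0r oppr0.
Qed.

Lemma arc_bounds i : (i < g)%N -> 0 < arc i < cyc i.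
Proof. by move=> ig; apply: arc_lenP. Qed.

(** In [2 * arc i = z * cyc i] the bounds [0 < arc i < cyc i] leave only [z = 1]. *)
Lemma torsion2 i : (i < g)%N -> torsion C i.+1 = 2%N -> cyc i = 2 * arc i.
Proof.
move=> /arc_bounds /andP[a0 al]; rewrite /torsion; case: asboolP => // _.
case: xgetP => // m _ [[_ [z hz]] _] m2; rewrite m2 in hz.
have z0 : 0 < z.
  have : 0 < z%:~R * cyc i by rewrite -hz; lra.
  by rewrite pmulr_lgt0 ?ltr0z //; lra.
have z2 : z < 2.
  rewrite -(@ltr_int R); have : z%:~R * cyc i < 2 * cyc i by rewrite -hz; lra.
  by rewrite ltr_pM2r //; lra.
have z1 : z = 1 by lia.
by rewrite z1 mul1r in hz.
Qed.

(** If [n] were nonzero, the ratio of the lengths would be rational and the set of multipliers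
    nonempty, so the torsion would be its positive minimum and not a default 0. *)
Lemma torsion0 i (n z : int) : (i < g)%N -> torsion C i.+1 = 0%N ->
  n%:~R * arc i = z%:~R * cyc i -> n = 0.
Proof.
move=> /arc_bounds /andP[a0 al] t0 E.
have [//|n0] := eqVneq n 0; exfalso; move: t0; rewrite /torsion.
set A := [set m | _].
have n0R : (n%:~R : R) != 0 by rewrite intr_eq0.
have z0 : z != 0.
  apply/eqP => z0; move/eqP: E; rewrite z0 mul0r mulf_eq0 (negbTE n0R).
  by rewrite [arc i == 0]gt_eqF.
have z0R : (z%:~R : R) != 0 by rewrite intr_eq0.
have An : A `|n|%N.
  split; first by rewrite absz_gt0.
  (* The sign of [n] is moved to the other side, since multipliers are positive. *)
  exists (sgz n * z); rewrite intrM -mulrA -E mulrA -intrM; congr (_ * _).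
  rewrite -[LHS]/((`|n|%N%:Z)%:~R) abszE; congr (_ %:~R).
  by rewrite normrEsg; case: (sgzP n).
rewrite asboolT; last first.
  exists (n%:~R / z%:~R); rewrite fmorph_div /= !ratr_int; apply: (mulfI z0R).
  by rewrite -E; field.
have exA : exists n, `[< A n >] by exists `|n|%N; exact/asboolP.
case: (ex_minnP exA) => m /asboolP Am mmin.
have [[x0 _] _] := @xgetPex _ 0%N (A `&` lbound A)
  (ex_intro _ m (conj Am (fun y Ay => mmin y (asboolT Ay)))).
by move=> xE; rewrite xE in x0.
Qed.

End ChainCoordinates.

(** * Lower bounds *)

Section RightDegree.
Context {R : realType} (C : chain_of_cycles R).
Local Notation g := (genus C).
Local Notation G := (chain_graph C).
Local Notation arc i := (arc_len C i.+1).
Local Notation cyc i := (cyc_len C i.+1).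
Implicit Types (D E : divisor G) (p : gpoint G).

(** For [d = 3 * i + 1] this counts the chips at or to the right of the vertex w of cycle [i], for
    [d = 3 * i + 2] those strictly to its right. *)
Definition right_degree (d : nat) D : int :=
  pairing (fun p => (d <= depth p)%N%:R) D.

Lemma right_degree0 D : right_degree 0 D = deg D.
Proof. by rewrite -[deg D]intz -pairing_deg. Qed.

Lemma right_degreeB (d d' : nat) D : (d <= d')%N ->
  right_degree d D - right_degree d' D =
  \sum_(p <- dom D) coeff p D * (d <= depth p < d')%N%:R.
Proof.
move=> dd'; rewrite /right_degree /pairing -sumrB; apply: eq_bigr => p _.
by rewrite !intz -mulrBr; congr (_ * _); do 3 case: leqP => //=; lia.
Qed.

Lemma right_degree_le (d d' : nat) D : effective D -> (d <= d')%N ->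
  right_degree d' D <= right_degree d D.
Proof.
move=> eD dd'; rewrite -subr_ge0 right_degreeB //.
by apply: sumr_ge0 => p _; rewrite mulr_ge0.
Qed.

Lemma right_degree_coeff (d d' : nat) D p : effective D ->
  (d <= depth p < d')%N -> right_degree d' D + coeff p D <= right_degree d D.
Proof.
move=> eD hp; have dd' : (d <= d')%N by lia.
rewrite addrC -lerBrDr right_degreeB //.
have [pD|] := boolP (p \in dom D); last first.
  move=> /coeff_outdom ->; apply: sumr_ge0 => q _; exact: mulr_ge0.
rewrite (bigD1_seq p) ?uniq_dom //= hp mulr1 lerDl.
by apply: sumr_ge0 => q _; rewrite mulr_ge0.
Qed.

Lemma right_degree_empty (d d' : nat) D p : effective D ->
  right_degree d D <= right_degree d' D -> p \in dom D ->
  ~~ (d <= depth p < d')%N.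
Proof.
move=> eD le pD; apply/negP => /(right_degree_coeff eD).
by have := eD p; move: pD; rewrite mem_dom; lia.
Qed.

(** Without chips on the cycle away from w, every chip retracts to v, at position 0, or to w, at
    position [arc i]. *)
Lemma pairing_coord (i : nat) D :
  (forall p, p \in dom D -> ~~ (3 * i <= depth p < 3 * i + 1)%N) ->
  pairing (coord i) D = (right_degree (3 * i + 1) D)%:~R * arc i.
Proof.
move=> H; rewrite /right_degree /pairing rmorph_sum big_distrl /=.
apply: eq_big_seq => p /H hp; rewrite intz intrM -mulrA; congr (_ * _).
case: leqP => hd; first by rewrite coord_right // mul1r.
by rewrite coord_left ?mul0r //; lia.
Qed.

End RightDegree.

(** * The lower bound for the degree of a divisor of rank 1 *)

Section LowerBound.
Context {R : realType} (C : chain_of_cycles R).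
Local Notation g := (genus C).
Local Notation G := (chain_graph C).
Local Notation arc i := (arc_len C i.+1).
Local Notation cyc i := (cyc_len C i.+1).
Implicit Types (D E : divisor G) (p : gpoint G).

Lemma general_Martens_special_seq k : general_Martens_special C k ->
  exists J : seq nat,
    [/\ size J = k, uniq J,
        forall j, j \in J -> (3 <= j <= g - 2)%N /\ j.-1 \notin J,
        forall j, j \in J -> torsion C j = 0%N
      & forall i, (2 <= i <= g)%N -> i \notin J -> torsion C i = 2%N].
Proof.
move=> [[J [sJ /allP aJ soJ tJ tN]] gen]; exists J.
set r := fun i i' : nat => _ in soJ.
have rtr : transitive r by move=> y x z; rewrite /r; lia.
split=> //.
- by apply: sorted_uniq soJ => // x; rewrite /r; lia.
- move=> j jJ; split; first exact: aJ.
  have /andP[j3 _] := aJ _ jJ.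
  apply/negP => jJ'; have := sorted_ltn_index rtr soJ.
  have [lt|lt|E] := ltngtP (index j J) (index j.-1 J).
  + by move/(_ j j.-1 jJ jJ' lt); rewrite /r; lia.
  + by move/(_ j.-1 j jJ' jJ lt); rewrite /r; lia.
  + by move: (nth_index 0%N jJ) (nth_index 0%N jJ'); rewrite E => ->; lia.
- move=> j jJ; have := aJ _ jJ => ?; apply: gen; [lia|exact: tJ].
Qed.

(** [N0] and [M0] are the extremal degrees N_1 and M_1. Indices here start at 0, so the first cycle
    has thresholds 1 and 2. *)
Lemma rank1_profile k D : (0 < k)%N -> general_Martens_special C k ->
  1 <= rk D ->
  exists N0 M0 : int, [/\
    exists D', [/\ effective D', lin_equiv D' D & right_degree 1 D' = N0],
    forall D', effective D' -> lin_equiv D' D -> M0 <= right_degree 2 D',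
    M0 + 1 <= N0
    & 2 * k%:Z + 2 + ((N0 - M0) %% 2)%Z <= N0 + M0].
Proof.
move=> k0 /general_Martens_special_seq[J [sJ uJ hJ J0 J2]] /rk_ge1P rkD.
pose S D' := effective D' /\ lin_equiv D' D.
have rdeg_bounds d D' : S D' -> 0 <= right_degree d D' <= deg D.
  move=> [eD' lD']; rewrite -(lin_equiv_deg lD') -right_degree0.
  rewrite right_degree_le // andbT; apply: sumr_ge0 => p _.
  by rewrite intz mulr_ge0.
have [D1 SD1] : exists D', S D'.
  by have [D' [? ? _]] := rkD (inl (Ordinal (genus_gt0 C), true)); exists D'.
have exN i : exists n : int,
    (exists2 D', S D' & right_degree (3 * i + 1) D' = n) /\
    forall D', S D' -> right_degree (3 * i + 1) D' <= n.
  pose A := [set n | exists2 D', S D' & right_degree (3 * i + 1) D' = n].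
  have [|n [D' SD' <-]|m [Am mub]] := @int_set_max A
    (right_degree (3 * i + 1) D1) (deg D); first by exists D1.
    by have /andP[] := rdeg_bounds (3 * i + 1)%N _ SD'.
  by exists m; split => // D' SD'; apply: mub; exists D'.
have [N hN] := choice exN.
have exM i : exists n : int,
    (exists2 D', S D' & right_degree (3 * i + 2) D' = n) /\
    forall D', S D' -> n <= right_degree (3 * i + 2) D'.
  pose A := [set n | exists2 D', S D' & right_degree (3 * i + 2) D' = n].
  have [|n [D' SD' <-]|m [Am mub]] := @int_set_min A
    (right_degree (3 * i + 2) D1) 0; first by exists D1.
    by have /andP[] := rdeg_bounds (3 * i + 2)%N _ SD'.
  by exists m; split => // D' SD'; apply: mub; exists D'.
have [M hM] := choice exM.
have hNM i : (i < g)%N -> M i + 1 <= N i.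
  move=> ig; pose w : gpoint G := inl (Ordinal ig, true).
  have [D' [eD' lD' c1]] := rkD w.
  have h1 := (hN i).2 D' (conj eD' lD'); have h2 := (hM i).2 D' (conj eD' lD').
  have hw : (3 * i + 1 <= depth w < 3 * i + 2)%N by rewrite /=; lia.
  by have := right_degree_coeff eD' hw; lia.
have hM0 : 0 <= M g.-1.
  have [D' SD' <-] := (hM g.-1).1.
  by have /andP[] := rdeg_bounds (3 * g.-1 + 2)%N _ SD'.
have hstep i : (i.+1 < g)%N -> [/\ N i.+1 <= N i, M i.+1 <= M i
     & N i.+1 = N i -> M i.+1 = M i ->
       i.+2 \notin J /\ ((N i - M i) %% 2)%Z = 0].
  (* [A] attains the maximum at the next cycle, [B] the minimum at the present one. If neither
     sequence drops, [A] has no chip from the present w up to, but excluding, the next w, and [B]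
     none strictly after the present w up to and including the next. Both position sums on the next
     cycle are then multiples of [arc]. *)
  move=> ig; have [A SA rA] := (hN i.+1).1; have [B SB rB] := (hM i).1.
  have A1 := (hN i).2 A SA; have B1 := (hM i.+1).2 B SB.
  have A2 := @right_degree_le _ _ (3 * i + 1) (3 * i.+1 + 1) A SA.1 ltac:(lia).
  have B2 := @right_degree_le _ _ (3 * i + 2) (3 * i.+1 + 1) B SB.1 ltac:(lia).
  have B3 := @right_degree_le _ _ (3 * i.+1 + 1) (3 * i.+1 + 2) B SB.1 ltac:(lia).
  split; [lia|lia|move=> Ni Mi].
  have EA : pairing (coord i.+1) A = (N i)%:~R * arc i.+1.
    rewrite pairing_coord ?rA ?Ni // => p pA.
    have := @right_degree_empty _ _ (3 * i + 1) (3 * i.+1 + 1)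
      A p SA.1 ltac:(lia) pA.
    lia.
  have EB : pairing (coord i.+1) B = (M i)%:~R * arc i.+1.
    rewrite pairing_coord => [|p pB].
      by congr (_ %:~R * _); lia.
    have := @right_degree_empty _ _ (3 * i + 2) (3 * i.+1 + 2)
      B p SB.1 ltac:(lia) pB.
    lia.
  have AB : lin_equiv A B := lin_equiv_trans SA.2 (lin_equiv_sym SB.2).
  have [z] := @principal_coord _ _ (Ordinal ig) _ AB.
  rewrite /= pairingB EA EB -mulrBl -intrB => E.
  have iJ : i.+2 \notin J.
    apply/negP => /J0 t0; have := torsion0 ig t0 E.
    by have := hNM i (ltnW ig); lia.
  split=> //; move: E; rewrite (torsion2 ig) ?J2 // mulrA.
  have /andP[a0 _] := arc_bounds ig.
  move/(mulIf (lt0r_neq0 a0)) => E.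
  have : N i - M i = z * 2 by apply: (@intr_inj R); rewrite E intrM.
  lia.
have Jg : (0 < size J)%N by rewrite sJ.
exists (N 0%N), (M 0%N); split.
- by have [D' [? ?] ?] := (hN 0%N).1; exists D'.
- by move=> D' eD' lD'; apply: (hM 0%N).2.
- exact: hNM (genus_gt0 C).
- by rewrite -sJ; exact: path_bound hstep.
Qed.

(** Adding [M + 1 <= N] to [2 * k + 2 <= N + M] gives [2 * k + 3 <= 2 * N], hence [k + 2 <= N]; and
    [N] chips occur in some effective divisor of the class. *)
Lemma rank1_deg k D : (0 < k)%N -> general_Martens_special C k ->
  1 <= rk D -> k%:Z + 2 <= deg D.
Proof.
move=> k0 Ck /(rank1_profile k0 Ck)[N [M [[D' [eD' lD' rD'] _ NM b]]]].
have := right_degree_le eD' (leq0n 1).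
by rewrite right_degree0 (lin_equiv_deg lD') rD'; lia.
Qed.

(* A divisor class of rank 1 and degree [k + 2] restricts to twice w on the first
   cycle, and v + w is not equivalent to 2w there. *)
Lemma rank1_first_cycle k (F : divisor G) (i0 : 'I_g) : (0 < k)%N ->
  general_Martens_special C k -> i0 = 0%N :> nat ->
  effective F -> deg F = k%:Z ->
  ~ 1 <= rk (<< inl (i0, false) : gpoint G >> + << inl (i0, true) >> + F).
Proof.
set v := inl _; set w := inl (i0, true).
move=> k0 Ck i00 eF dF; set D := _ + F => rD.
have eD : effective D by do 2 apply: effectiveD => //; apply: effectiveU.
have dD : deg D = k%:Z + 2 by rewrite !degD !degU dF; lia.
have [N [M [[D' [eD' lD' rD'] Mmin NM b]]]] := rank1_profile k0 Ck rD.
have D'0 := right_degree_le eD' (leq0n 1).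
rewrite right_degree0 (lin_equiv_deg lD') dD rD' in D'0.
have M2 := Mmin D eD (lin_equiv_refl D).
have F12 := right_degree_le eF (leqnSn 1).
have F01 := right_degree_le eF (leq0n 1); rewrite right_degree0 in F01.
have D2 : right_degree 2 D = right_degree 2 F.
  by rewrite /right_degree !pairingD !pairingU /= i00 /= !mulr0 !add0r.
(* The degree gives [N <= k + 2], and [D] itself gives [M <= k]; equality holds in both. So [D']
   lies entirely at or beyond w, and [F] strictly beyond w. *)
have NE : N = k%:Z + 2 by lia.
have FE : right_degree 1 F = k%:Z by lia.
have [z] := @principal_coord _ _ i0 _ (lin_equiv_sym lD').
rewrite i00 pairingB !pairingD !pairingU !(pairing_coord (i := 0)).
- rewrite rD' FE NE /= i00 /= !intrD mul1r add0r => E.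
  have /andP[a0 al] := arc_bounds (genus_gt0 C).
  (* The position sums are [(k + 1) * arc 0] for [D] and [(k + 2) * arc 0] for [D'], so [arc 0]
     would be a multiple of [cyc 0]. *)
  have {}E : arc 0 = (- z)%:~R * cyc 0 by rewrite intrN mulNr -E; ring.
  have z1 : - z < 1.
    rewrite -(@ltr_int R) -(@ltr_pM2r _ (cyc 0)) -?E; lra.
  have z0 : 0 < - z.
    rewrite -(@ltr_int R) -(@ltr_pM2r _ (cyc 0)) -?E; lra.
  lia.
- move=> p pD; apply: right_degree_empty pD => //.
  by rewrite right_degree0 (lin_equiv_deg lD') dD rD' NE.
- by move=> p pF; apply: right_degree_empty pF => //; rewrite right_degree0 FE dF.
Qed.

End LowerBound.

(** * Functions with prescribed slopes *)

Section Ramps.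
Context {R : realType}.
Implicit Types (s : seq (int * R)).

(** The function that vanishes far to the left and whose slope increases by [c.1] at each [c.2]. *)
Definition ramps s (t : R) := \sum_(c <- s) c.1%:~R * Num.max 0 (t - c.2).

Lemma ramp_slope_right (c t : R) :
  is_slope (fun u => Num.max 0 (u - c)) t 1 (c <= t)%R%:R.
Proof.
have [ct|tc] := leP c t.
  exists 1 => // h /andP[h0 _]; rewrite !mul1r !max_r; first ring; lra.
exists (c - t); first by lra.
by move=> h ?; rewrite mul0r addr0 !max_l //; lra.
Qed.

Lemma ramp_slope_left (c t : R) :
  is_slope (fun u => Num.max 0 (u - c)) t (-1) (- (c < t)%R%:R).
Proof.
have [ct|tc] := ltP c t.
  exists (t - c) => [|h ?]; first by lra.
  by rewrite mulN1r !max_r; [ring|lra|lra].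
by exists 1 => // h /andP[h0 _]; rewrite oppr0 mul0r addr0 !max_l //; lra.
Qed.

Lemma is_slope_sum (I : eqType) (r : seq I) (phi : I -> R -> R) (m : I -> R)
    (n : I -> R) t sgn : (forall i, is_slope (phi i) t sgn (n i)) ->
  is_slope (fun u => \sum_(i <- r) m i * phi i u) t sgn (\sum_(i <- r) m i * n i).
Proof.
move=> H; elim: r => [|i r [d d0 IH]].
  by exists 1 => // h _; rewrite !big_nil mul0r addr0.
have [d' d'0 Hi] := H i.
exists (Num.min d d'); first by rewrite lt_min d0.
move=> h /andP[h0]; rewrite lt_min => /andP[hd hd'].
by rewrite !big_cons IH ?Hi ?h0 //; ring.
Qed.

Lemma ramps_slope_right s t :
  is_slope (ramps s) t 1 (\sum_(c <- s) c.1%:~R * (c.2 <= t)%R%:R).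
Proof. by apply: is_slope_sum => c; exact: ramp_slope_right. Qed.

Lemma ramps_slope_left s t :
  is_slope (ramps s) t (-1) (\sum_(c <- s) c.1%:~R * - (c.2 < t)%R%:R).
Proof. by apply: is_slope_sum => c; exact: ramp_slope_left. Qed.

Lemma ramps_continuous s : continuous (ramps s).
Proof.
move=> x; rewrite /ramps; elim: s => [|c s IH].
  rewrite (_ : (fun t => _) = fun=> 0); first exact: cvg_cst.
  by apply/funext => t; rewrite big_nil.
rewrite (_ : (fun t => _) = fun t => c.1%:~R * Num.max 0 (t - c.2) +
   \sum_(c <- s) c.1%:~R * Num.max 0 (t - c.2)); last first.
  by apply/funext => t; rewrite big_cons.
apply: cvgD IH; apply: cvgM; first exact: cvg_cst.
apply: (@continuous_max R R (fun=> 0) (fun t => t - c.2)); first exact: cvg_cst.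
by apply: cvgB; [exact: cvg_id|exact: cvg_cst].
Qed.

Lemma ramps_affine s (a b : R) : a < b ->
  (forall c, c \in s -> ~~ (a < c.2 < b)) ->
  exists (n : int) (d : R), forall t, a < t < b -> ramps s t = n%:~R * t + d.
Proof.
move=> ab; elim: s => [|c s IH] H.
  by exists 0, 0 => t _; rewrite /ramps big_nil; ring.
have [x xs|n [d nd]] := IH; first by apply: H; rewrite inE xs orbT.
have cab := H c (mem_head _ _).
have [ca|ac] := leP c.2 a.
  exists (c.1 + n), (d - c.1%:~R * c.2) => t tab.
  rewrite /ramps big_cons -/(ramps s t) nd // max_r ?intrD; first ring; lra.
exists n, d => t tab; rewrite /ramps big_cons -/(ramps s t) nd // max_l; first ring.
by move: cab; rewrite ac /= -leNgt; lra.
Qed.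

End Ramps.

(** * Rational functions obtained from a coordinate on the graph *)

Section RampFunctions.
Context {R : realType} {G : metric_graph R}.
Variables (s : seq (int * R)) (f : gpoint G -> R).
(** [off e] is the coordinate at the source of [e]; [dir e] tells whether the coordinate grows at
    unit speed along [e] or is constant there. *)
Variables (off : edge G -> R) (dir : edge G -> bool).
Hypothesis fE : forall (e : edge G) (t : R), 0 <= t <= len e ->
  f (edge_pt e t) = ramps s (off e + (dir e)%:R * t).

Lemma ramps_rational : rational_function f.
Proof.
move=> e; split.
  apply: (@subspace_eq_continuous R `[0, len e] R
    (fun t => ramps s (off e + (dir e)%:R * t))).
    by move=> t; rewrite inE /= in_itv /= => /fE fEt; exact: esym fEt.
  apply: continuous_subspaceT => t.
  apply: (@continuous_comp R R R (fun t => off e + (dir e)%:R * t) (ramps s) t).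
    apply: cvgD; first exact: cvg_cst.
    by apply: cvgM; [exact: cvg_cst|exact: cvg_id].
  exact: ramps_continuous.
case: (dir e) (@fE e) => fEe; last first.
  exists [::] => a b a0 bL _; exists 0, (ramps s (off e)) => t tab.
  by rewrite fEe ?mul0r ?addr0 ?add0r //; lra.
exists [seq c.2 - off e | c <- s] => a b a0 bL H.
have [ab|ba] := ltP a b; last by exists 0, 0 => t; lra.
have [|c cs|n [d nd]] := @ramps_affine _ s (off e + a) (off e + b).
- by lra.
- have := H (c.2 - off e) (map_f (fun c => c.2 - off e) cs).
  by apply: contraNN; lra.
exists n, (d + n%:~R * off e) => t tab; rewrite fEe; last by lra.
rewrite /= mulr1n mul1r nd; first ring; lra.
Qed.

Lemma ramps_outslope_right (e : edge G) (t : R) : 0 <= t < len e ->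
  outslope (f \o edge_pt e) t 1 =
  (dir e)%:R * \sum_(c <- s) c.1%:~R * (c.2 <= off e + t)%R%:R.
Proof.
move=> tl; apply: outslopeE; have [d d0 H] := ramps_slope_right s (off e + t).
exists (Num.min d (len e - t)); first by rewrite lt_min d0; lra.
move=> h /andP[h0]; rewrite lt_min => /andP[hd hl].
rewrite /= !fE; [|lra|lra].
case: (dir e); last by rewrite !mul0r !addr0.
by have := H h; rewrite h0 hd !mul1r addrA => /(_ isT) ->.
Qed.

Lemma ramps_outslope_left (e : edge G) (t : R) : 0 < t <= len e ->
  outslope (f \o edge_pt e) t (-1) =
  - ((dir e)%:R * \sum_(c <- s) c.1%:~R * (c.2 < off e + t)%R%:R).
Proof.
move=> tl; apply: outslopeE; have [d d0 H] := ramps_slope_left s (off e + t).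
exists (Num.min d t); first by rewrite lt_min d0; lra.
move=> h /andP[h0]; rewrite lt_min => /andP[hd hl].
rewrite /= !fE; [|lra|lra].
case: (dir e); last by rewrite !mul0r oppr0 mul0r !addr0.
rewrite !mul1r addrA H ?h0 //; congr (_ + _ * _).
by rewrite -sumrN; apply: eq_bigr => c _; rewrite mulrN.
Qed.

Lemma ramps_ord_edge (e : edge G) (t : R) : 0 < t < len e ->
  ord_at f (edge_pt e t) =
  (dir e)%:R * \sum_(c <- s) c.1%:~R * (c.2 == off e + t)%:R.
Proof.
move=> ht; have /andP[t0 tl] := ht.
rewrite ord_at_edge // ramps_outslope_right ?ramps_outslope_left; [|lra|lra].
rewrite -mulrBr -sumrB; congr (_ * _); apply: eq_bigr => c _.
rewrite -mulrBr; congr (_ * _).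
by case: ltgtP => _; rewrite ?subrr ?subr0.
Qed.

Lemma ramps_ord_vertex v :
  ord_at f (inl v) =
  \sum_e (dir e)%:R * ((src e == v)%:R * \sum_(c <- s) c.1%:~R * (c.2 <= off e)%R%:R
    - (tgt e == v)%:R * \sum_(c <- s) c.1%:~R * (c.2 < off e + len e)%R%:R).
Proof.
rewrite /= [X in X + _]big_mkcond [X in _ + X]big_mkcond -big_split /=.
apply: eq_bigr => e _; have e0 := len_gt0 e.
rewrite ramps_outslope_right ?ramps_outslope_left; [|lra|lra].
by rewrite addr0; do 2 case: eqP => _; do ?rewrite mul1r; do ?rewrite mul0r; ring.
Qed.

End RampFunctions.

(** * Principal divisors on chains of cycles *)

Section ChainPrincipal.
Context {R : realType} (C : chain_of_cycles R).
Local Notation g := (genus C).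
Local Notation G := (chain_graph C).
Local Notation arc i := (arc_len C i.+1).
Local Notation cyc i := (cyc_len C i.+1).

(** The inverse of [coord i] on the cycle, for [x] in [[0, cyc i)]. *)
Definition cycle_pt (i : 'I_g) (x : R) : gpoint G :=
  if x < arc i then edge_pt (inl (i, false) : edge G) x
  else edge_pt (inl (i, true) : edge G) (x - arc i).

Lemma coord_edge_ge0 i (e : edge G) (t : R) : 0 <= t < len e ->
  coord i (edge_pt e t) = coord_off i e + (on_cycle i e)%:R * t.
Proof.
move=> /andP[]; rewrite le_eqVlt => /orP[/eqP <- _|t0 tl].
  by rewrite edge_pt_src coord_src mulr0 addr0.
by rewrite coord_edge // t0.
Qed.

Lemma cycle_pt_edge (i : 'I_g) (x : R) : 0 <= x < cyc i ->
  exists (b : bool) (t : R), [/\ 0 <= t < len (inl (i, b) : edge G),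
    cycle_pt i x = edge_pt (inl (i, b) : edge G) t
    & x = coord_off i (inl (i, b) : edge G) + t].
Proof.
move=> hx; rewrite /cycle_pt; have [xa|ax] := ltP x (arc i).
  by exists false, x; rewrite /= ltnn eqxx add0r; split => //; lra.
by exists true, (x - arc i); rewrite /= ltnn eqxx; split => //; [lra|ring].
Qed.

Lemma coord_cycle_pt (i : 'I_g) (x : R) : 0 <= x < cyc i ->
  coord i (cycle_pt i x) = x.
Proof.
move=> /cycle_pt_edge[b [t [ht -> ->]]].
by rewrite coord_edge_ge0 // [on_cycle _ _]eqxx mul1r.
Qed.

Lemma depth_cycle_pt (i : 'I_g) (x : R) : 0 <= x < cyc i ->
  (3 * i <= depth (cycle_pt i x) <= 3 * i + 1)%N.
Proof.
move=> /cycle_pt_edge[b [t [/andP[]]]]; rewrite le_eqVlt.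
move=> /orP[/eqP <- _ -> _|t0 tl -> _]; last by rewrite depth_edge ?t0 //; lia.
by rewrite edge_pt_src /=; case: b; lia.
Qed.

Lemma coordK (i : 'I_g) (p : gpoint G) : (3 * i <= depth p <= 3 * i + 1)%N ->
  0 <= coord i p < cyc i /\ cycle_pt i (coord i p) = p.
Proof.
have /andP[a0 al] := arc_bounds (ltn_ord i).
elim/(@gpointP R G): p => [[j b]|e t ht].
  move=> /= hj; have {j hj} -> : j = i.
    by apply: val_inj => /=; case: b hj => /=; lia.
  rewrite ltnn eqxx /cycle_pt; case: b; last first.
    by rewrite a0 edge_pt_src lexx; split => //; lra.
  by rewrite ltxx subrr edge_pt_src; split => //; lra.
rewrite depth_edge // => hd; rewrite coord_edge //.
case: e ht hd => [[j b]|j] ht hd; last by lia.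
have E : j = i by apply: val_inj => /=; lia.
move: ht; rewrite {j hd}E /= ltnn eqxx mul1r /cycle_pt; case: b => ht.
  have lt : (arc i + t < arc i) = false by apply/negP; lra.
  by rewrite lt [arc i + t - _]addrAC subrr add0r; split; first lra.
have /andP[t0 ta] := ht.
by rewrite add0r ta; split => //; lra.
Qed.

Lemma cycle_pt_eq (i : 'I_g) (x : R) (p : gpoint G) : 0 <= x < cyc i ->
  (cycle_pt i x == p) =
  (x == coord i p) && (3 * i <= depth p <= 3 * i + 1)%N.
Proof.
move=> hx; apply/eqP/andP => [<-|[/eqP -> /coordK[]//]].
by rewrite coord_cycle_pt // eqxx depth_cycle_pt.
Qed.

(** A converse of [principal_coord] for divisors of degree 0 supported on one cycle. *)
Lemma principal_cycle (i : 'I_g) (s : seq (int * R)) (z : int) :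
  (forall c, c \in s -> 0 <= c.2 < cyc i) ->
  \sum_(c <- s) c.1 = 0 -> \sum_(c <- s) c.1%:~R * c.2 = z%:~R * cyc i ->
  principal (\sum_(c <- s) << c.1 *g cycle_pt i c.2 >>).
Proof.
have /andP[a0 al] := arc_bounds (ltn_ord i).
(* The initial slope [z] at v is what makes the function return to 0 after one turn, so that it is
   well defined on the cycle. *)
move=> hs s0 sz; pose s' := (z, 0) :: s.
have s0R : \sum_(c <- s) c.1%:~R = 0 :> R by rewrite -rmorph_sum s0.
have r0 : ramps s' 0 = 0.
  rewrite /ramps big_cons /= subrr maxxx mulr0 add0r big_seq big1 // => c cs.
  by rewrite max_l ?mulr0 //; have := hs c cs; lra.
have rl : ramps s' (cyc i) = 0.
  rewrite /ramps big_cons /= subr0 max_r; last by lra.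
  rewrite (eq_big_seq (fun c => c.1%:~R * cyc i - c.1%:~R * c.2)).
    by rewrite sumrB -big_distrl /= s0R sz; ring.
  by move=> c cs /=; rewrite max_r; [ring|have := hs c cs; lra].
pose f (p : gpoint G) := ramps s' (coord i p).
have fE (e : edge G) (t : R) : 0 <= t <= len e ->
    f (edge_pt e t) = ramps s' (coord_off i e + (on_cycle i e)%:R * t).
  move=> /andP[t0]; rewrite le_eqVlt => /orP[/eqP ->|tl]; last first.
    by rewrite /f coord_edge_ge0 // t0.
  rewrite /f edge_pt_tgt; have [->|ne] := eqVneq e (inl (i, true)).
    by rewrite /= ltnn eqxx mul1r addrC subrK r0 rl.
  by rewrite coord_tgt.
exists f; first exact: ramps_rational fE.
have coeffE p : (coeff p (\sum_(c <- s) << c.1 *g cycle_pt i c.2 >>))%:~R =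
    \sum_(c <- s) c.1%:~R * ((c.2 == coord i p)
      && (3 * i <= depth p <= 3 * i + 1)%N)%:R :> R.
  rewrite raddf_sum rmorph_sum; apply: eq_big_seq => c cs /=.
  by rewrite coeffU cycle_pt_eq ?hs // intrM natz.
have sum_s' (P : pred R) : \sum_(c <- s') c.1%:~R * (P c.2)%:R =
    z%:~R * (P 0)%:R + \sum_(c <- s) c.1%:~R * (P c.2)%:R :> R.
  by rewrite big_cons.
(* The turn also ends with slope [z], so the artificial break at v contributes nothing to the
   divisor. *)
have cyc_sum : \sum_(c <- s') c.1%:~R * (c.2 < cyc i)%R%:R = z%:~R :> R.
  rewrite (sum_s' (fun x => x < cyc i)) (lt_trans a0 al) mulr1.
  rewrite (eq_big_seq (fun c => c.1%:~R)) ?s0R ?addr0 // => c cs.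
  by have /andP[_ ->] := hs c cs; rewrite mulr1.
apply: gpointP => [[j b]|e t ht]; rewrite coeffE.
  rewrite (ramps_ord_vertex fE) (@sum_cycle_edges _ _ _ i); last first.
    move=> [[h b']|h] /= n1 n2; last by rewrite mul0r.
    have [E|ni] := eqVneq h i.
      by move: n1 n2; rewrite E; case: b'; rewrite eqxx.
    by rewrite (negbTE (ni : (h : nat) != i)) mul0r.
  rewrite /= ltnn eqxx !mul1r add0r [arc i + _]addrC subrK cyc_sum !xpair_eqE.
  have [<-|ne] := eqVneq i j; last first.
    rewrite !mul0r subrr addr0 big1 // => c _.
    have {}ne : (j : nat) != i by rewrite eq_sym.
    by rewrite [X in _ && X](_ : _ = false) ?andbF ?mulr0 //; case: b; lia.
  rewrite ltnn eqxx; case: b => /=; last first.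
    rewrite !mul0r !mul1r subr0 add0r (sum_s' (fun x => x <= 0)) lexx mulr1.
    rewrite addrAC subrr add0r; apply: eq_big_seq => c cs.
    rewrite [X in _ && X](_ : _ = true) ?andbT; last by lia.
    have /andP[c0 _] := hs c cs.
    by rewrite [c.2 <= 0]le_eqVlt [c.2 < 0]ltNge c0 orbF.
  rewrite !mul0r !mul1r subr0 sub0r (sum_s' (fun x => x <= arc i)).
  rewrite (sum_s' (fun x => x < arc i)) a0 (ltW a0) !mulr1.
  rewrite addrC opprD addrACA subrr add0r -sumrB; apply: eq_bigr => c _.
  rewrite [X in _ && X](_ : _ = true) ?andbT; last by lia.
  by rewrite -mulrBr; congr (_ * _); case: ltgtP => _; rewrite ?subrr ?subr0.
rewrite (ramps_ord_edge fE) // coord_edge // depth_edge //.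
case: e ht => [[j b]|j] ht /=; last first.
  rewrite !mul0r big1 // => c _.
  by rewrite [X in _ && X](_ : _ = false) ?andbF ?mulr0 //; lia.
have [->|ne] := eqVneq j i; last first.
  have {}ne : (j : nat) != i := ne.
  rewrite (negbTE ne) !mul0r big1 // => c _.
  by rewrite [X in _ && X](_ : _ = false) ?andbF ?mulr0 //; lia.
rewrite ltnn eqxx !mul1r (sum_s' (fun x => x == _)).
rewrite [0 == _](_ : _ = false) ?mulr0 ?add0r; last first.
  by apply/eqP; case: b ht => /=; lra.
apply: eq_bigr => c _.
by rewrite [X in _ && X](_ : _ = true) ?andbT //; lia.
Qed.

Definition segment_off (i : nat) (e : chain_edge C) : R :=
  match e with
  | inl (j, _) => if (j <= i)%N then 0 else seg_len C i.+1
  | inr j => if (j <= i)%N then 0 else seg_len C i.+1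
  end.

(** A segment is a bridge: the function equal to 0 on its left, rising with slope 1 up to [c] and
    constant from there on is well defined. *)
Lemma principal_segment (i : 'I_g.-1) (c : R) (e : edge G) : e = inr i ->
  0 < c <= len e ->
  principal (<< inl (src e) : gpoint G >> - << edge_pt e c >>).
Proof.
move=> eE hc; pose s : seq (int * R) := [:: (1, 0); (-1, c)].
pose h (p : gpoint G) : R := match p with
  | inl x => segment_off i (inl x)
  | inr x => segment_off i (val x).1 + ((val x).1 == e)%:R * (val x).2
  end.
pose f p := ramps s (h p).
have fE (e' : edge G) (t : R) : 0 <= t <= len e' ->
    f (edge_pt e' t) = ramps s (segment_off i e' + (e' == e)%:R * t).
  move=> /andP[]; rewrite le_eqVlt => /orP[/eqP <- _|t0].
    rewrite edge_pt_src mulr0 addr0 /f; congr (ramps s _).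
    by case: (e') => [[j b]|j].
  rewrite le_eqVlt => /orP[/eqP ->|tl]; last first.
    by rewrite /f (@edge_pt_in _ _ e' t) //= t0.
  rewrite edge_pt_tgt /f; congr (ramps s _); rewrite eE.
  case: e' {t0} => [[j b]|j] /=; first by rewrite mul0r addr0.
  have [[->]|ne] := eqVneq (inr j : edge G) (inr i).
    by rewrite ltnn leqnn mul1r add0r.
  have {}ne : (j : nat) != i by apply: contraNneq ne => /val_inj ->.
  by rewrite mul0r addr0; case: (leqP j i); case: (leqP j.+1 i) => //; lia.
exists f; first exact: ramps_rational fE.
have offe : segment_off i e = 0 by rewrite eE /= leqnn.
have sumE (P : pred R) : \sum_(c <- s) c.1%:~R * (P c.2)%:R =
    (P 0)%:R - (P c)%:R :> R.
  by rewrite big_cons big_seq1 /= mul1r mulN1r.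
apply: gpointP => [v|e' t ht]; rewrite coeffB !coeffU !mul1r intrB !natz.
  rewrite (ramps_ord_vertex fE) (bigD1 e) //= [X in _ = _ + X]big1; last first.
    by move=> e' /negbTE ->; rewrite mul0r.
  rewrite eqxx mul1r addr0 offe add0r (sumE (fun x => x <= 0)).
  rewrite (sumE (fun x => x < len e)) lexx len_gt0.
  rewrite [c <= 0](_ : _ = false) ?subr0 ?mulr1; last by apply/negP; lra.
  congr (_ - _); have /andP[c0] := hc; rewrite le_eqVlt => /orP[/eqP ->|cl].
    by rewrite edge_pt_tgt ltxx subr0 mulr1.
  by rewrite cl subrr mulr0 eq_sym vertex_neq_edge_pt // c0.
rewrite (ramps_ord_edge fE) // (sumE (fun x => x == _)).
rewrite vertex_neq_edge_pt // edge_pt_eq //; last by lra.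
rewrite sub0r; have [->|_] := eqVneq e' e; last by rewrite mul0r oppr0.
rewrite mul1r offe add0r [0 == t](_ : _ = false) ?sub0r //.
by apply/eqP; lra.
Qed.

End ChainPrincipal.

(** * A divisor of rank 1 *)

Section Existence.
Context {R : realType} (C : chain_of_cycles R).
Local Notation g := (genus C).
Local Notation G := (chain_graph C).
Local Notation arc i := (arc_len C i.+1).
Local Notation cyc i := (cyc_len C i.+1).
Local Notation v i := (inl (i, false) : gpoint G).
Local Notation w i := (inl (i, true) : gpoint G).

Lemma cycle_pt0 (i : 'I_g) : cycle_pt i 0 = v i.
Proof.
have /andP[a0 _] := arc_bounds (ltn_ord i).
by rewrite /cycle_pt a0 edge_pt_src.
Qed.

Lemma cycle_pt_arc (i : 'I_g) : cycle_pt i (arc i) = w i.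
Proof. by rewrite /cycle_pt ltxx subrr edge_pt_src. Qed.

(** Reflection about w: [u] is [2 * arc i - x] modulo [cyc i], and one shift suffices since this
    number lies between [- cyc i] and [2 * cyc i]. *)
Lemma double_w_reflect (i : 'I_g) (x : R) : 0 <= x < cyc i ->
  exists u : R, lin_equiv (<< cycle_pt i x >> + << cycle_pt i u >>) (<< w i >> *+ 2).
Proof.
have /andP[a0 al] := arc_bounds (ltn_ord i); move=> hx.
have [u [z [hu E]]] : exists (u : R) (z : int),
    0 <= u < cyc i /\ x + u - 2 * arc i = z%:~R * cyc i.
  have [n0|n0] := ltP (2 * arc i - x) 0.
    by exists (2 * arc i - x + cyc i), 1; split; [lra|ring].
  have [n1|n1] := ltP (2 * arc i - x) (cyc i).
    by exists (2 * arc i - x), 0; split; [lra|ring].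
  by exists (2 * arc i - x - cyc i), (-1); split; [lra|ring].
exists u; pose s : seq (int * R) := [:: (1, x); (1, u); (- 2, arc i)].
have := @principal_cycle _ _ i s z.
rewrite !big_cons !big_nil /= !addr0 cycle_pt_arc => pr.
rewrite /lin_equiv -addrA freeg_muln freegUN; apply: pr.
- move=> c; rewrite !inE => /or3P[]/eqP -> /=; lra.
- by [].
- by rewrite -E; ring.
Qed.

Lemma lin_equivMn2 (D1 D2 : divisor G) :
  lin_equiv D1 D2 -> lin_equiv (D1 *+ 2) (D2 *+ 2).
Proof.
by move=> l; rewrite /lin_equiv -mulrnBl mulr2n; exact: principalD.
Qed.

Lemma double_w_segment n (hn : (n < g)%N) (hn1 : (n.+1 < g)%N) :
  lin_equiv (<< w (Ordinal hn) >> *+ 2) (<< v (Ordinal hn1) >> *+ 2).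
Proof.
apply: lin_equivMn2; have hj : (n < g.-1)%N by rewrite ltn_predRL.
pose e : edge G := inr (Ordinal hj).
have := @principal_segment _ _ (Ordinal hj) (len e) e erefl.
rewrite len_gt0 lexx edge_pt_tgt => /(_ isT).
have -> : src e = (Ordinal hn, true) by congr (_, _); exact: val_inj.
by have -> : tgt e = (Ordinal hn1, false) by congr (_, _); exact: val_inj.
Qed.

Lemma double_v_hyperelliptic (i : 'I_g) : torsion C i.+1 = 2%N ->
  lin_equiv (<< v i >> *+ 2) (<< w i >> *+ 2).
Proof.
move=> /(torsion2 (ltn_ord i)) E.
have /andP[a0 al] := arc_bounds (ltn_ord i).
have := @principal_cycle _ _ i [:: (2, 0); (- 2, arc i)] (-1).
rewrite !big_cons !big_nil /= !addr0 cycle_pt_arc cycle_pt0 => pr.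
rewrite /lin_equiv !freeg_muln freegUN; apply: pr.
- move=> c; rewrite !inE => /orP[]/eqP -> /=; lra.
- by [].
- by rewrite E; ring.
Qed.

(** Valid for any torsion, as the positions of w and of the second point add up to [cyc i]. *)
Lemma double_v_generic (i : 'I_g) :
  lin_equiv (<< v i >> *+ 2) (<< w i >> + << cycle_pt i (cyc i - arc i) >>).
Proof.
have /andP[a0 al] := arc_bounds (ltn_ord i).
have := @principal_cycle _ _ i [:: (2, 0); (-1, arc i); (-1, cyc i - arc i)] (-1).
rewrite !big_cons !big_nil /= !addr0 cycle_pt_arc cycle_pt0 => pr.
rewrite /lin_equiv !freeg_muln opprD !freegUN; apply: pr.
- move=> c; rewrite !inE => /or3P[]/eqP -> /=; lra.
- by [].
- by ring.
Qed.

Section Divisor.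
Variable J : seq nat.
Hypothesis J1 : 1%N \notin J.
Hypothesis J2 : forall i, (2 <= i <= g)%N -> i \notin J -> torsion C i = 2%N.

Definition cycle_chip (h : 'I_g) : divisor G :=
  if h.+1 \in J then << w h >> else 0.

Definition rank1_divisor : divisor G :=
  << w (Ordinal (genus_gt0 C)) >> *+ 2 + \sum_h cycle_chip h.

Lemma cycle_chip_effective h : effective (cycle_chip h).
Proof.
by rewrite /cycle_chip; case: ifP => _; [exact: effectiveU|exact: effective0].
Qed.

Lemma sum_cycle_chip_effective (P : pred 'I_g) :
  effective (\sum_(h | P h) cycle_chip h).
Proof.
apply: (big_ind (fun D => effective D)).
- exact: effective0.
- by move=> *; exact: effectiveD.
- by move=> *; exact: cycle_chip_effective.
Qed.

(** The pair of chips has moved to cycle [n]: [F] consists of chips left behind, and the chips of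
    later special cycles are still in place. *)
Lemma rank1_divisor_step n (hn : (n < g)%N) : exists F : divisor G,
  effective F /\
  lin_equiv (<< w (Ordinal hn) >> *+ 2 + F +
    \sum_(h : 'I_g | (n < h)%N) cycle_chip h) rank1_divisor.
Proof.
elim: n hn => [|n IH] hn.
  exists 0; split; first exact: effective0.
  rewrite /rank1_divisor.
  rewrite [X in lin_equiv _ (_ + X)](bigD1 (Ordinal (genus_gt0 C))) //=.
  have -> : cycle_chip (Ordinal (genus_gt0 C)) = 0.
    by rewrite /cycle_chip /= (negbTE J1).
  rewrite add0r addr0.
  rewrite (_ : Ordinal hn = Ordinal (genus_gt0 C)); last exact: val_inj.
  rewrite (eq_bigl (fun h => h != Ordinal (genus_gt0 C))).
    exact: lin_equiv_refl.
  by move=> h; rewrite lt0n.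
have hn' := ltnW hn; have [F [eF lF]] := IH hn'.
set D := \sum_(h : 'I_g | _) _.
have DE : \sum_(h : 'I_g | (n < h)%N) cycle_chip h = cycle_chip (Ordinal hn) + D.
  rewrite (bigD1 (Ordinal hn)) //=; congr (_ + _); apply: eq_bigl => h.
  by rewrite [RHS]ltn_neqAle andbC eq_sym.
(* On a special cycle the pair at v becomes w plus one further point; that point stays behind and
   the chip waiting at w completes the new pair. *)
have [F' eF' lF'] : exists2 F', effective F' &
    lin_equiv (<< w (Ordinal hn) >> *+ 2 + F')
      (<< w (Ordinal hn') >> *+ 2 + cycle_chip (Ordinal hn)).
  rewrite /cycle_chip; case: ifP => [_|nJ].
    exists << cycle_pt (Ordinal hn) (cyc n.+1 - arc n.+1) >>.
      exact: effectiveU.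
    rewrite mulr2n -addrA [X in lin_equiv X _]addrC; apply: lin_equiv_addr.
    apply: lin_equiv_sym; apply: lin_equiv_trans (double_w_segment hn' hn) _.
    exact: double_v_generic.
  exists 0; first exact: effective0.
  rewrite !addr0; apply: lin_equiv_sym.
  apply: lin_equiv_trans (double_w_segment hn' hn) _.
  by apply: double_v_hyperelliptic; apply: J2; rewrite /= ?nJ.
exists (F' + F); split; first exact: effectiveD.
apply: lin_equiv_trans lF; rewrite DE !addrA.
apply: lin_equiv_addr; rewrite [X in lin_equiv _ X]addrAC.
exact: lin_equiv_addr.
Qed.

Lemma rank1_divisor_rk : 1 <= rk rank1_divisor.
Proof.
apply/rk_ge1P => p.
(* It suffices to place a chip at [p] using a pair [2 w] alone: by reflection if [p] lies on a
   cycle, by sliding both chips to [p] if it lies inside a segment. *)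
suff [i [E eE lE]] : exists (i : 'I_g), exists2 E : divisor G,
    effective E & lin_equiv (<< p >> + E) (<< w i >> *+ 2).
  have [F [eF lF]] := rank1_divisor_step (ltn_ord i).
  set D := \sum_(h : 'I_g | _) _ in lF.
  have eEFD : effective (E + F + D).
    apply: effectiveD; first exact: effectiveD.
    exact: sum_cycle_chip_effective.
  exists (<< p >> + (E + F + D)); split.
  - by apply: effectiveD eEFD; exact: effectiveU.
  - apply: lin_equiv_trans lF; rewrite !addrA.
    rewrite (_ : Ordinal (ltn_ord i) = i); last exact: val_inj.
    by do 2 apply: lin_equiv_addr.
  - by rewrite coeffD coeffU eqxx mulr1 lerDl.
have on_cycle_pt (i : 'I_g) (q : gpoint G) : (3 * i <= depth q <= 3 * i + 1)%N ->
    exists (i : 'I_g), exists2 E : divisor G,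
      effective E & lin_equiv (<< q >> + E) (<< w i >> *+ 2).
  move=> /coordK[hx <-]; have [u lu] := double_w_reflect hx.
  by exists i, << cycle_pt i u >> => //; exact: effectiveU.
elim/(@gpointP R G): p => [[j b]|e t ht].
  by apply: (on_cycle_pt j) => /=; case: b; lia.
case: e ht => [[j b]|j] ht.
  by apply: (on_cycle_pt j); rewrite depth_edge //; lia.
exists (Ordinal (seg_src_subproof j)), << edge_pt (inr j : edge G) t >>.
  exact: effectiveU.
rewrite -mulr2n; apply: lin_equivMn2; apply: lin_equiv_sym.
apply: (@principal_segment _ _ j t (inr j) erefl).
by have /andP[-> /ltW ->] := ht.
Qed.

Lemma rank1_divisor_deg : uniq J -> (forall j, j \in J -> (1 <= j <= g)%N) ->
  deg rank1_divisor = (size J)%:Z + 2.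
Proof.
move=> uJ hJ; rewrite degD degMn degU addrC; congr (_ + _).
rewrite raddf_sum /= (eq_bigr (fun h : 'I_g => (h.+1 \in J)%:Z)); last first.
  by move=> h _; rewrite /cycle_chip; case: ifP => _; rewrite ?degU ?deg0.
rewrite -(big_mkord xpredT (fun h => (h.+1 \in J)%:Z)).
have -> : size J = count (mem J) (iota 1 g).
  rewrite -size_filter; apply: perm_size; apply: uniq_perm => //.
    exact: filter_uniq (iota_uniq _ _).
  move=> j; rewrite mem_filter mem_iota inE; case jJ: (j \in J) => //=.
  by have := hJ _ jJ; lia.
rewrite -sum1_count (iotaDl 1 0) big_map /index_iota subn0.
rewrite -natz natr_sum [RHS]big_mkcond /=; apply: eq_bigr => h _.
by rewrite add1n; case: (_ \in J).
Qed.

End Divisor.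
End Existence.

(** * The gonality and the Brill-Noether number *)

Theorem theoremA (R : realType) (k : nat) (C : chain_of_cycles R) :
  (1 <= k)%N -> general_Martens_special C k ->
  BN_number (chain_graph C) 1 (k + 2) = 0%R /\
  gonality (chain_graph C) = Posz (k + 2).
Proof.
move=> k0 Ck.
have [J [sJ uJ hJ _ J2]] := general_Martens_special_seq Ck.
have J1 : 1%N \notin J by apply/negP => /hJ[].
pose D0 : divisor (chain_graph C) := rank1_divisor C J.
have rD0 : 1 <= rk D0 by exact: rank1_divisor_rk.
have dD0 : deg D0 = Posz (k + 2).
  rewrite rank1_divisor_deg // ?sJ // => j /hJ[]; lia.
split; last first.
  apply: xget_unique.
    split; first by exists D0.
    by move=> n [D [<- rD]]; have := rank1_deg k0 Ck rD; lia.
  move=> n [[D [dD rD]] ln]; have /= := ln (Posz (k + 2)).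
  have := rank1_deg k0 Ck rD; rewrite dD => h1 h2.
  have {}h2 : n <= Posz (k + 2) by apply: h2; exists D0.
  lia.
rewrite /BN_number asboolT; last by exists D0.
apply: largest_eq.
  split=> // E eE; rewrite add0r => /(deg1_effective eE)[p ->].
  have [D [eD lD cD]] := (rk_ge1P D0).1 rD0 p.
  exists D; split => //.
  - by rewrite (lin_equiv_deg lD).
  - move=> q; rewrite coeffB coeffU mul1r.
    by have [<-|_] := eqVneq p q; rewrite ?subr_ge0 // subr0.
  - exact: rk_ge1_equiv (lin_equiv_sym lD) rD0.
move=> n [n0 H]; rewrite leNgt; apply/negP => n1.
pose i0 := Ordinal (genus_gt0 C).
pose v : gpoint (chain_graph C) := inl (i0, false).
pose w : gpoint (chain_graph C) := inl (i0, true).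
(* For [n >= 1] the test divisor is v_1 + w_1, padded by [n - 1] further chips at v_1 to degree
   [n + 1]. A divisor containing it is v_1 + w_1 plus an effective [F] of degree [k], which
   [rank1_first_cycle] excludes. *)
have eE : effective (<< (n - 1) *g v >> : divisor (chain_graph C)).
  by apply: effectiveU; lia.
have [||D [eD dD eDE rD]] := H (<< v >> + << w >> + << (n - 1) *g v >>).
- by apply: effectiveD => //; apply: effectiveD; exact: effectiveU.
- by rewrite !degD !degU; lia.
pose F := D - (<< v >> + << w >>).
apply: (@rank1_first_cycle _ C k F i0) => //.
- have -> : F = D - (<< v >> + << w >> + << (n - 1) *g v >>) + << (n - 1) *g v >>.
    by rewrite opprD addrA subrK.
  exact: effectiveD.
- by rewrite degB degD !degU dD; lia.
- by rewrite addrC subrK.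
Qed.
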